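(* Assume that there are constants $\pi\ge1$, $C_{V,\lambda}\ge1$, $c_\lambda>0$ such that: (i) for all $t\ge t'\ge t_\circ$, the sequence $\Big(\frac{1-\gamma_i^{(t')}}{1-\gamma_i^{(t)}}\Big)_{i=1,\dots,D}$ with values in $[0,\infty]$ is nonincreasing in $i$; (ii) for all $i'\le i$ and $t\ge t_\circ$: $\gamma_i^{(t)}\le\gamma_{i'}^{(t)}$; (iii) for all $t\ge t'\ge t_\circ$: $V_t\le C_{V,\lambda}(V_{t,\lambda}/V_{t',\lambda})^\pi V_{t'}$; (iv) for every $k=1,\dots,D$: $\frac1k\sum_{i=1}^k\lambda_i^{-2}\ge c_\lambda^2\lambda_k^{-2}$. Then there are constants $c_1,c_2>0$ depending on $c_\lambda$ only such that for every $x\ge1$, with probability at least $1-c_1e^{-c_2x}$, $$\|\widehat\mu^{(\tau)}-\mu\|^2\le K\,\mathbb{E}\big[\|\widehat\mu^{(t^\ast)}-\mu\|^2\big]+2\delta^2x\lambda_{\lfloor x\rfloor\wedge D}^{-2},$$ where $$K=4C_{V,\lambda}\Big(1+\Big(\frac{(4\sqrt D+12)\delta^2+\sqrt{32}\,\delta B_{t^\ast,\lambda}(\mu)}{\mathbf 1(t^\ast>t_\circ)\min\big(V_{t^\ast,\lambda},B_{t^\ast,\lambda}^2(\mu)\big)+\mathbf 1(t^\ast=t_\circ)V_{t_\circ,\lambda}}\,x\Big)^{1/2}\Big)^{2\pi}.$$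
   Context: Fix $D\in\mathbb{N}$, a noise level $\delta>0$, numbers $1\ge\lambda_1\ge\dots\ge\lambda_D>0$ and a signal $\mu\in\mathbb{R}^D$. One observes $Y_i=\lambda_i\mu_i+\delta\varepsilon_i$, $i=1,\dots,D$, with $\varepsilon_i$ independent standard normal. Filters: for each $i$, $t\mapsto\gamma_i^{(t)}\in[0,1]$, $t\ge0$, is continuous and nondecreasing with $\gamma_i^{(0)}=0$ and $\gamma_i^{(t)}\uparrow1$ as $t\to\infty$. Estimators: $\widehat\mu_i^{(t)}=\gamma_i^{(t)}\lambda_i^{-1}Y_i$. $\|\cdot\|$ is the Euclidean norm on $\mathbb{R}^D$. Notation: $R_t^2=\sum_i(1-\gamma_i^{(t)})^2Y_i^2$; $V_t=\delta^2\sum_i(\gamma_i^{(t)})^2\lambda_i^{-2}$; $V_{t,\lambda}=\delta^2\sum_i(\gamma_i^{(t)})^2$; $B_{t,\lambda}^2(\mu)=\sum_i(1-\gamma_i^{(t)})^2\lambda_i^2\mu_i^2$ with $B_{t,\lambda}(\mu)\ge0$. Initial step: $t_\circ=\inf\{t\ge0:V_{t,\lambda}=C_\circ D^{1/2}\delta^2\}$ for a constant $C_\circ\ge1$ with $C_\circ<D^{1/2}$. For a threshold $\kappa>0$: $\tau=\inf\{t\ge t_\circ:R_t^2\le\kappa\}$ and $t^\ast=\inf\{t\ge t_\circ:\mathbb{E}[R_t^2]\le\kappa\}$. Conventions: in the ratio in (i), $c/0=+\infty$ for every $c\ge0$; and $K=+\infty$ if the denominator in its definition vanishes. $a\wedge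 b=\min(a,b)$. *)

(* Defs.v *)
From HB Require Import structures.
From mathcomp Require Import all_boot all_order all_algebra.
From mathcomp Require Import all_classical all_reals all_analysis.

Set Implicit Arguments.
Unset Strict Implicit.
Unset Printing Implicit Defensive.

Import Order.TTheory GRing.Theory Num.Theory.
Import numFieldNormedType.Exports.

Local Open Scope classical_set_scope.
Local Open Scope ring_scope.

Definition mutually_independent (d : measure_display) (T : measurableType d)
    (R : realType) (P : probability T R) (I : finType)
    (X : I -> {RV P >-> R}) : Prop :=
  forall (J : {set I}) (A : I -> set R),
    (forall i, i \in J -> measurable (A i)) ->
    P (\bigcap_(i in [set` J]) (X i @^-1` A i)) =
      (\prod_(i in J) P (X i @^-1` A i))%E.

Definition standard_normal (d : measure_display) (T : measurableType d)
    (R : realType) (P : probability T R) (X : {RV P >-> R}) : Prop :=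
  forall A : set R, measurable A -> distribution P X A = normal_prob 0 1 A.

Definition spectral_filter (R : realType) (g : R -> R) : Prop :=
  [/\ forall t : R, 0 <= t -> 0 <= g t <= 1,
      {within `[0, +oo[, continuous g},
      forall s t : R, 0 <= s -> s <= t -> g s <= g t,
      g 0 = 0
    & g t @[t --> +oo] --> (1 : R)].

(* The norm that the library puts on 'rV[R]_D is the sup norm. *)
Definition enorm (R : realType) (D : nat) (v : 'rV[R]_D) : R :=
  Num.sqrt (\sum_(i < D) v 0 i ^+ 2).

(* The entry v_k of v = (v_1, ..., v_D), for 1 <= k <= D: the mathematical
   index k is the ordinal k - 1. *)
Definition entry (R : realType) (D : nat) (v : 'I_D -> R) (k : nat) : R :=
  nth 0 (codom v) k.-1.

(* c / d in [0, +oo], for c, d >= 0, with c / 0 = +oo including c = 0; the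
   library's division on \bar R has 0 / 0 = 0. *)
Definition ratio_infty (R : realType) (c d : R) : \bar R :=
  if d == 0 then +oo%E else (c / d)%:E.

Section SequenceModel.
Variables (R : realType) (D : nat).
Implicit Types (gamma : 'I_D -> R -> R) (lambda : 'I_D -> R).
Implicit Types (mu y : 'rV[R]_D) (delta t : R).

Definition observation lambda mu delta (e : 'I_D -> R) : 'rV[R]_D :=
  \row_i (lambda i * mu 0 i + delta * e i).

Definition estimator gamma lambda y t : 'rV[R]_D :=
  \row_i (gamma i t * (lambda i)^-1 * y 0 i).

Definition residual2 gamma y t : R :=
  \sum_(i < D) (1 - gamma i t) ^+ 2 * y 0 i ^+ 2.

Definition strong_variance gamma lambda delta t : R :=
  delta ^+ 2 * \sum_(i < D) gamma i t ^+ 2 * lambda i ^- 2.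

Definition weak_variance gamma delta t : R :=
  delta ^+ 2 * \sum_(i < D) gamma i t ^+ 2.

Definition weak_bias gamma lambda mu t : R :=
  Num.sqrt (\sum_(i < D) (1 - gamma i t) ^+ 2 * lambda i ^+ 2 * mu 0 i ^+ 2).

Definition initial_time gamma delta (Ccirc : R) : R :=
  inf [set t | 0 <= t /\
    weak_variance gamma delta t = Ccirc * Num.sqrt D%:R * delta ^+ 2].

Definition stopping_time gamma (t0 kappa : R) y : R :=
  inf [set t | t0 <= t /\ residual2 gamma y t <= kappa].

(* Y is the observation as a random vector. *)
Definition oracle_time (d : measure_display) (T : measurableType d)
    (P : probability T R) gamma (t0 kappa : R) (Y : T -> 'rV[R]_D) : R :=
  inf [set t | t0 <= t /\
    ('E_P[fun w => residual2 gamma (Y w) t] <= kappa%:E)%E].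

Definition oracle_factor gamma lambda mu delta (CV p t0 tstar x : R) : \bar R :=
  let B := weak_bias gamma lambda mu tstar in
  let den := (t0 < tstar)%R%:R * Num.min (weak_variance gamma delta tstar) (B ^+ 2)
             + (tstar == t0)%R%:R * weak_variance gamma delta t0 in
  if den == 0 then +oo%E
  else (4 * CV *
    (1 + Num.sqrt (((4 * Num.sqrt D%:R + 12) * delta ^+ 2
                    + Num.sqrt 32 * delta * B) / den * x)) `^ (2 * p))%:E.

End SequenceModel.

(* Main.v *)
Require Import Defs.
From HB Require Import structures.
From mathcomp Require Import all_boot all_order all_algebra.
From mathcomp Require Import all_classical all_reals all_analysis.
From mathcomp Require Import measurable_realfun zify ring lra.

Set Implicit Arguments.
Unset Strict Implicit.
Unset Printing Implicit Defensive.

Import Order.TTheory GRing.Theory Num.Theory.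
Import numFieldNormedType.Exports.

Local Open Scope classical_set_scope.
Local Open Scope ring_scope.

(** Along the path, [2 B_t^2 + 2 S_t] bounds the loss, where the strong bias
    [B_t^2] decreases in [t] and the weighted noise [S_t] is controlled by the
    strong variance, uniformly in [t]: since the filters decrease in the index,
    Abel summation reduces this to the partial sums of
    [lambda_i^-2 eps_i^2], whose chi-square deviations are summable in the
    length by (iv).

    It remains to compare [tau] with [t*]. Both [R_t^2] and [E R_t^2] decrease
    in [t], so stopping at a time of too large weak bias (resp. weak variance)
    forces [R_t^2] to deviate from its mean at one deterministic time: the one
    at which the weak bias (resp. variance) crosses the tolerated level. The
    moment generating function of [(m + sigma eps)^2] bounds the probability of
    both deviations. For [tau <= t*] the weak bias bound is transferred to the
    strong bias by (i) and Chebyshev's sum inequality, and for [tau >= t*] the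
    weak variance bound is transferred to the strong variance by (iii). *)

(** * Gaussian integrals and independence *)

Section Density.
Context d d' (T : measurableType d) (T' : measurableType d') (R : realType).
Variables (P : {measure set T -> \bar R}) (nu : {measure set T' -> \bar R}).
Variables (X : T -> T') (h : T -> R) (c : R).
Hypotheses (mX : measurable_fun setT X) (mh : measurable_fun setT h).
Hypotheses (h0 : forall x, 0 <= h x) (c0 : 0 <= c).
Hypothesis hind : forall A, measurable A ->
  (\int[P]_x (h x * \1_A (X x))%:E = c%:E * nu A)%E.

Import HBNNSimple.

(* Covers both a density [h] on the space of [X] itself and, for [X] one of
   several independent variables, a product [h] of functions of the others. *)
Lemma ge0_integral_density (f : T' -> R) : measurable_fun setT f ->
  (forall y, 0 <= f y) ->
  (\int[P]_x (h x * f (X x))%:E = c%:E * \int[nu]_y (f y)%:E)%E.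
Proof.
move=> mf f0.
have /measurable_EFinP mEf := mf.
have Ef0 : forall y, setT y -> (0 <= (EFin \o f) y)%E.
  by move=> y _; rewrite lee_fin.
pose g := nnsfun_approx measurableT mEf.
have fE y : ((EFin \o g n) y @[n --> \oo] --> (f y)%:E)%E.
  exact: (cvg_nnsfun_approx measurableT mEf Ef0).
have ndg m n : (m <= n)%N -> forall y, g m y <= g n y.
  by move=> mn y; exact/lefP/nd_nnsfun_approx.
have nu1 : (c%:E * \int[nu]_y (f y)%:E =
    lim (\int[nu]_y (c * g n y)%:E @[n --> \oo]))%E.
  rewrite -ge0_integralZl//.
  have gE y : ((c * g n y)%:E @[n --> \oo] --> (c%:E * (f y)%:E))%E.
    by under eq_fun do rewrite EFinM; apply: cvgeZl => //; exact: fE.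
  under eq_integral do rewrite -(cvg_lim (@ereal_hausdorff R) (gE _)).
  apply: monotone_convergence => //.
  - by move=> n; apply/measurable_EFinP; exact: measurable_funM.
  - by move=> n y _ /=; rewrite lee_fin mulr_ge0.
  - by move=> y _ a b ab; rewrite lee_fin ler_wpM2l// ndg.
have P1 : (\int[P]_x (h x * f (X x))%:E =
    lim (\int[P]_x (h x * g n (X x))%:E @[n --> \oo]))%E.
  have gE x : ((h x * g n (X x))%:E @[n --> \oo] --> (h x * f (X x))%:E)%E.
    under eq_fun do rewrite EFinM.
    by rewrite EFinM; apply: cvgeZl => //; exact: fE.
  under eq_integral do rewrite -(cvg_lim (@ereal_hausdorff R) (gE _)).
  apply: monotone_convergence => //.
  - move=> n; apply/measurable_EFinP; apply: measurable_funM => //.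
    exact: measurableT_comp.
  - by move=> n y _ /=; rewrite lee_fin mulr_ge0.
  - by move=> y _ a b ab; rewrite lee_fin ler_wpM2l// ndg.
rewrite nu1 P1; congr (lim (_ @ \oo)); apply/funext => n.
(* What remains is a simple function; it is split into its finitely many level sets, and [hind]
   applies to the indicator of each. *)
have r0 r : (range (g n)) r -> 0 <= r by move=> [y _ <-].
have ri r y : 0 <= r * \1_(g n @^-1` [set r]) y :> R.
  rewrite indicE; have [|_] := boolP (y \in _); last by rewrite mulr0.
  by rewrite inE /= => <-; rewrite mulr1.
transitivity (\int[nu]_y
   (\sum_(r \in range (g n)) (c * (r * \1_(g n @^-1` [set r]) y))%:E))%E;
  last first.
  apply: eq_integral => y _; rewrite fsumEFin// [in RHS](fimfunE (g n) y).
  by rewrite -mulr_fsumr.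
transitivity (\int[P]_x (\sum_(r \in range (g n))
    (h x * (r * \1_(g n @^-1` [set r]) (X x)))%:E))%E.
  apply: eq_integral => y _; rewrite fsumEFin// [in LHS](fimfunE (g n) (X y)).
  by rewrite -mulr_fsumr.
have mI r : measurable_fun setT (\1_(g n @^-1` [set r]) : T' -> R).
  exact: measurable_indic.
have mIX r : measurable_fun setT (fun x => \1_(g n @^-1` [set r]) (X x) : R).
  exact: (measurableT_comp (mI r) mX).
rewrite (ge0_integral_fsum _ _ (fun r x => _))//=; last 2 first.
- move=> r; apply/measurable_EFinP; apply: measurable_funM => //.
  exact: measurable_funM.
- by move=> r x _; rewrite lee_fin mulr_ge0.
rewrite (ge0_integral_fsum _ _ (fun r y => _))//=; last 2 first.
- move=> r; apply/measurable_EFinP; apply: measurable_funM => //.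
  exact: measurable_funM.
- by move=> r y _; rewrite lee_fin mulr_ge0.
apply: eq_fsbigr => r /[!inE] rg.
under eq_integral do rewrite mulrCA EFinM.
under [RHS]eq_integral do rewrite mulrA EFinM.
rewrite ge0_integralZl//; last 3 first.
- by apply/measurable_EFinP; exact: measurable_funM.
- by move=> x _; rewrite lee_fin mulr_ge0.
- by rewrite lee_fin r0.
rewrite hind// ge0_integralZl//.
- by rewrite integral_indic// setIT EFinM muleA (muleC r%:E).
- exact/measurable_EFinP.
- by rewrite lee_fin mulr_ge0// r0.
Qed.

End Density.

Lemma ge0_integral_normal_prob (R : realType) (m s : R) (f : R -> R) :
  measurable_fun setT f -> (forall y, 0 <= f y) ->
  (\int[normal_prob m s]_x (f x)%:E =
   \int[lebesgue_measure]_x (normal_pdf m s x * f x)%:E)%E.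
Proof.
move=> mf f0; rewrite -[LHS]mul1e; apply/esym.
apply: (@ge0_integral_density _ _ _ _ R lebesgue_measure (normal_prob m s)
  idfun (normal_pdf m s) 1) => //.
- exact: measurable_id.
- exact: measurable_normal_pdf.
- by move=> x; exact: normal_pdf_ge0.
- move=> A mA; rewrite mul1e /normal_prob [RHS]integral_mkcond.
  apply: eq_integral => x _; rewrite EFinM.
  by rewrite epatch_indic.
Qed.

(* Completing the square: the tilted density is again Gaussian. *)
Lemma normal_pdf_expR_sqr (R : realType) (m s sigma x : R) :
  let v := 1 - 2 * (s * sigma ^+ 2) in 0 < v ->
  normal_pdf 0 1 x * expR (s * (m + sigma * x) ^+ 2) =
  (Num.sqrt v)^-1 * expR (s * m ^+ 2 / v) *
  normal_pdf (2 * s * m * sigma / v) (Num.sqrt v)^-1 x.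
Proof.
move=> v v0.
have sv0 : Num.sqrt v != 0 by rewrite gt_eqF// sqrtr_gt0.
rewrite !normal_pdfE ?oner_eq0 ?invr_eq0// /normal_peak.
rewrite exprVn sqr_sqrtr ?(ltW v0)// expr1n mul1r -mulrnAr.
rewrite sqrtrM ?invr_ge0 ?(ltW v0)// sqrtrV ?(ltW v0)// invfM invrK.
rewrite [in RHS]mulrACA. rewrite mulKf// -[LHS]mulrA; congr (_ * _).
rewrite /normal_fun exprVn sqr_sqrtr ?(ltW v0)// -!expRD; congr expR.
have vn0 : v != 0 by rewrite gt_eqF.
have h1 : (1 : R) ^+ 2 *+ 2 != 0 by rewrite expr1n pnatr_eq0.
rewrite -mulr_natr expr1n subr0 mul1r -(mulr_natr v^-1) invfM invrK.
rewrite /v; field; exact: vn0.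
Qed.

(** After squaring, [1 / (1 - 2u) = 1 + 2u / (1 - 2u)] is at most the exponential of
    [2u / (1 - 2u)], which is at most [2u + 8u^2] because [1 - 2u >= 1/2]. *)
Lemma invr_sqrt_le_expR (R : realType) (u : R) : `|u| <= 1 / 4 ->
  (Num.sqrt (1 - 2 * u))^-1 <= expR (u + 4 * u ^+ 2).
Proof.
rewrite ler_norml => /andP[u1 u2].
have v0 : 0 < 1 - 2 * u by lra.
rewrite -sqrtrV ?(ltW v0)// -(ler_pXn2r (n := 2)) ?nnegrE ?expR_ge0//.
rewrite sqr_sqrtr ?invr_ge0 ?(ltW v0)// -expRM_natl.
apply: le_trans (_ : 1 + 2 * u / (1 - 2 * u) <= _).
  rewrite [leRHS](_ : _ = (1 - 2 * u)^-1)//; field; lra.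
apply: (le_trans (expR_ge1Dx _)); rewrite ler_expR ler_pdivrMr//.
nra.
Qed.

(** The tilted density integrates to one, so only the prefactor has to be bounded, to second order
    in [s]. Both signs of [s] are allowed, which later gives both tails. *)
Lemma normal_mgf_sqr_le (R : realType) (m s sigma : R) :
  `|s * sigma ^+ 2| <= 1 / 4 ->
  (\int[normal_prob 0 1]_x (expR (s * (m + sigma * x) ^+ 2))%:E <=
   (expR (s * (m ^+ 2 + sigma ^+ 2) +
          4 * s ^+ 2 * (sigma ^+ 4 + sigma ^+ 2 * m ^+ 2)))%:E)%E.
Proof.
move=> hu; set u := s * sigma ^+ 2 in hu; set v := 1 - 2 * u.
have /andP[u1 u2] : - (1 / 4) <= u <= 1 / 4 by rewrite -ler_norml.
have v0 : 0 < v by rewrite /v; lra.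
have mf : measurable_fun setT (fun x => expR (s * (m + sigma * x) ^+ 2)).
  apply: measurableT_comp => //; apply: measurable_funM => //.
  by apply: measurable_funX; exact: measurable_funD.
rewrite ge0_integral_normal_prob//.
under eq_integral do rewrite normal_pdf_expR_sqr// EFinM.
rewrite ge0_integralZl//; last 2 first.
- by apply/measurable_EFinP; exact: measurable_normal_pdf.
- by move=> x _; rewrite lee_fin normal_pdf_ge0.
rewrite integral_normal_pdf mule1 lee_fin.
apply: (le_trans (ler_wpM2r (expR_ge0 _) (invr_sqrt_le_expR hu))).
rewrite -expRD ler_expR.
(* Since [1 / v = 1 + 2u / v], the excess over the first-order term is quadratic in [s];
   [1 / v <= 2] then bounds it. *)
have -> : s * m ^+ 2 / v = s * m ^+ 2 + 2 * s ^+ 2 * sigma ^+ 2 * m ^+ 2 / v.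
  rewrite /v /u; field; rewrite -/u; exact: lt0r_neq0.
have : 2 * s ^+ 2 * sigma ^+ 2 * m ^+ 2 / v <=
    2 * (2 * s ^+ 2 * sigma ^+ 2 * m ^+ 2).
  rewrite ler_pdivrMr// [leRHS]mulrAC ler_peMl//; last by rewrite /v; lra.
  by do 3 rewrite mulr_ge0 ?sqr_ge0//.
rewrite /u; lra.
Qed.

Lemma le0_of_le_small (R : realType) (a C s1 : R) : 0 <= C -> 0 < s1 ->
  (forall s, 0 < s -> s <= s1 -> a <= s * C) -> a <= 0.
Proof.
move=> C0 s10 H; rewrite leNgt; apply/negP => a0.
pose s := Num.min s1 (a / (2 * (C + 1))).
have C1 : 0 < 2 * (C + 1) by lra.
have s0 : 0 < s by rewrite lt_min s10 divr_gt0.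
have ss1 : s <= s1 by rewrite ge_min lexx.
have sC : s * (2 * (C + 1)) <= a by rewrite -ler_pdivlMr// ge_min lexx orbT.
have := H _ s0 ss1; lra.
Qed.

(* Recovers a mean from upper bounds on the moment generating function near [0],
   on both sides. *)
Lemma eq_of_expR_quadratic_bounds (R : realType) (e A K s0 : R) :
  0 <= e -> 0 <= A -> 0 <= K -> 0 < s0 ->
  (forall s, 0 < s -> s <= s0 -> 1 + s * e <= expR (s * A + K * s ^+ 2)) ->
  (forall s, 0 < s -> s <= s0 -> 1 <= expR (- s * A + K * s ^+ 2) + s * e) ->
  e = A.
Proof.
move=> e0 A0 K0 s00 Hp Hm.
(* This turns the exponential bounds into polynomial ones, provided [1 - y >= 0]; the choice of [s1]
   keeps the exponents below 1. *)
have expM (y : R) : expR y * (1 - y) <= 1.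
  by rewrite -ler_pdivlMl ?expR_gt0// -expRN mulr1 expR_ge1Dx.
pose s1 := Num.min s0 (1 + A + K)^-1.
have AK : 0 < 1 + A + K by lra.
have s10 : 0 < s1 by rewrite lt_min s00 invr_gt0.
have s1P s : s <= s1 -> s <= s0 /\ s * (1 + A + K) <= 1.
  by rewrite le_min => /andP[-> ?]; rewrite -ler_pdivlMr// div1r.
apply/eqP; rewrite eq_le -(subr_le0 e A) -(subr_le0 A e); apply/andP; split.
- apply: (@le0_of_le_small _ _ (K + e * (A + K)) s1) => //.
    by rewrite addr_ge0// mulr_ge0// addr_ge0.
  move=> s sp /s1P[ss0 sAK].
  have s_1 : s <= 1 by nra.
  have y1 : 0 <= 1 - (s * A + K * s ^+ 2) by nra.
  have := le_trans (ler_wpM2r y1 (Hp s sp ss0)) (expM _).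
  rewrite [leLHS](_ : _ = 1 + s * ((e - A) - s * (K + e * (A + K * s))));
    last by ring.
  rewrite gerDl pmulr_rle0// subr_le0 => /le_trans; apply.
  rewrite ler_pM2l// lerD2l ler_wpM2l// lerD2l; nra.
- apply: (@le0_of_le_small _ _ (K + e * A) s1) => //.
    by rewrite addr_ge0// mulr_ge0.
  move=> s sp /s1P[ss0 sAK].
  have s_1 : s <= 1 by nra.
  have y1 : 0 <= 1 - (- s * A + K * s ^+ 2) by nra.
  have := Hm s sp ss0; rewrite -lerBlDr.
  move=> /(ler_wpM2r y1)/le_trans/(_ (expM _)).
  rewrite [leLHS](_ : _ = 1 + s * ((A - e) - s * (K + e * (A - K * s))));
    last by ring.
  rewrite gerDl pmulr_rle0// subr_le0 => /le_trans; apply.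
  rewrite ler_pM2l// lerD2l ler_wpM2l//; nra.
Qed.

Section Independence.
Context d (T : measurableType d) (R : realType) (P : probability T R).
Variables (I : finType) (X : I -> {RV P >-> R}).
Hypothesis indX : mutually_independent X.

Lemma indep_expectation_prod (f : I -> R -> R) (e : I -> R) :
  (forall i, measurable_fun setT (f i)) -> (forall i x, 0 <= f i x) ->
  (forall i, (\int[P]_w (f i (X i w))%:E = (e i)%:E)%E) ->
  (\int[P]_w (\prod_i f i (X i w))%:E = (\prod_i e i)%:E)%E.
Proof.
move=> mf f0 fe.
have e0 i : 0 <= e i.
  by rewrite -lee_fin -fe; apply: integral_ge0 => w _; rewrite lee_fin.
(* An interpolation between events and functions: for empty [J] the product formula is the
   independence hypothesis, for full [J] it is the claim. *)
pose F (J : {set I}) (A : I -> set R) i x := if i \in J then f i x else \1_(A i) x.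
pose E (J : {set I}) (A : I -> set R) i :=
  if i \in J then e i else fine (P (X i @^-1` A i)).
have mF J A i : (forall i, measurable (A i)) -> measurable_fun setT (F J A i).
  by move=> mA; rewrite /F; case: (i \in J) => //; exact: measurable_indic.
have F0 J A i x : 0 <= F J A i x by rewrite /F; case: ifP.
have E0 J A i : 0 <= E J A i.
  by rewrite /E; case: ifP => // _; rewrite fine_ge0.
suff H (J : {set I}) (A : I -> set R) : (forall i, measurable (A i)) ->
    (\int[P]_w (\prod_i F J A i (X i w))%:E = (\prod_i E J A i)%:E)%E.
  have FT A i x : F [set: I]%SET A i x = f i x by rewrite /F finset.in_setT.
  have ET A i : E [set: I]%SET A i = e i by rewrite /E finset.in_setT.
  have := H [set: I]%SET (fun=> setT) (fun=> measurableT).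
  under eq_integral => w _ do under eq_bigr => i _ do rewrite FT.
  by rewrite (eq_bigr e (fun i _ => ET _ i)).
(* The indicators are replaced by the [f i] one coordinate at a time. *)
have [n] := ubnP #|J|; elim: n => // n IH in J A *; rewrite ltnS => Jn mA.
have mFX i : measurable_fun setT (fun w => F J A i (X i w)).
  by apply: measurableT_comp => //; exact: mF.
have [J0|[i0 iJ]] := set_0Vmem J.
  have PA := indX (J := [set: I]%SET) (A := A) (fun i _ => mA i).
  transitivity (P (\bigcap_(i in [set` [set: I]%SET]) (X i @^-1` A i))).
    rewrite -[X in _ = P X]setIT -integral_indic//; last first.
      apply: fin_bigcap_measurable; first exact: finite_finset.
      by move=> i _; rewrite -[X in measurable X]setTI; exact: measurable_funP.
    apply: eq_integral => w _; congr EFin; rewrite /F J0.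
    under eq_bigr do rewrite inE.
    rewrite indicE; have [|] := boolP (w \in _).
      rewrite inE => wA; apply: big1 => i _.
      by rewrite indicE mem_set//; apply: wA; rewrite /= inE.
    rewrite notin_setE => nwA; apply/eqP/prodf_eq0.
    have /existsNP[i Ai] : ~ (forall i, A i (X i w)).
      by move=> H; apply: nwA => i _; exact: H.
    by exists i => //; rewrite indicE memNset.
  rewrite PA (@big_morph _ _ EFin 1%E mule 1 *%R)//.
  apply: eq_big => i; rewrite ?inE//.
  by move=> _; rewrite /E J0 inE fineK// fin_num_measure//
    -[X in measurable X]setTI; exact: measurable_funP.
have iE (G : I -> R) : \prod_i G i = (\prod_(i | i != i0) G i) * G i0.
  by rewrite (bigD1 i0)//= mulrC.
have Fi0 (w : T) : F J A i0 (X i0 w) = f i0 (X i0 w) by rewrite /F iJ.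
under eq_integral do rewrite iE Fi0.
rewrite iE EFinM {2}/E iJ -fe.
rewrite -(@ge0_integral_distribution _ _ _ _ _ _ (X i0) (EFin \o f i0))//;
  last 2 first.
- exact/measurable_EFinP.
- by move=> y; rewrite lee_fin.
(* The product over the other coordinates acts as the density [h], and the law of [X i0] as [nu].
   The condition left for each measurable [B] is the induction hypothesis for [J] without [i0], with
   [A i0] replaced by [B]. *)
apply: (@ge0_integral_density _ _ _ _ _ _ (distribution P (X i0)) (X i0)) => //.
- by under eq_fun do rewrite -big_filter; exact: measurable_prod.
- by move=> w; exact: prodr_ge0.
- exact: prodr_ge0.
move=> B mB.
pose J' := (J :\ i0)%SET; pose A' i := if i == i0 then B else A i.
have mA' i : measurable (A' i) by rewrite /A'; case: ifP.
have J'n : (#|J'| < n)%N by move: Jn; rewrite (cardsD1 i0) iJ.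
have J'i i : i != i0 -> (i \in J') = (i \in J) by move=> ii; rewrite !inE ii.
transitivity (\int[P]_w (\prod_i F J' A' i (X i w))%:E)%E.
  apply: eq_integral => w _; rewrite iE; congr (EFin (_ * _)).
  - by apply: eq_bigr => i ii; rewrite /F /A' J'i// (negbTE ii).
  - by rewrite /F /A' !inE eqxx.
rewrite IH// iE EFinM; congr (_%:E * _)%E.
- by apply: eq_bigr => i ii; rewrite /E /A' J'i// (negbTE ii).
- rewrite /E /A' !inE eqxx /= fineK// fin_num_measure//.
  by rewrite -[X in measurable X]setTI; exact: measurable_funP.
Qed.

End Independence.

Section GaussianQuadratic.
Context d (T : measurableType d) (R : realType) (P : probability T R).

Lemma standard_normal_ge0_integral (X : {RV P >-> R}) (f : R -> R) :
  standard_normal X -> measurable_fun setT f -> (forall x, 0 <= f x) ->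
  (\int[P]_w (f (X w))%:E = \int[normal_prob 0 1]_x (f x)%:E)%E.
Proof.
move=> nX mf f0; rewrite -[RHS]mul1e.
under eq_integral do rewrite -[f _]mul1r.
apply: (@ge0_integral_density _ _ _ _ _ P (normal_prob 0 1) X (cst 1)) => //.
  exact: (measurable_funP X).
move=> A mA; rewrite mul1e; transitivity (distribution P X A); last exact: nX.
rewrite /distribution /pushforward.
rewrite -[X in _ = P X]setIT -integral_indic//; last first.
  by rewrite -[X in measurable X]setTI; exact: measurable_funP.
by apply: eq_integral => w _; rewrite mul1r !indicE.
Qed.

Lemma measurable_expR_sqr (m s sigma : R) :
  measurable_fun setT (fun x : R => expR (s * (m + sigma * x) ^+ 2)).
Proof.
apply: measurableT_comp => //; apply: measurable_funM => //.
by apply: measurable_funX; exact: measurable_funD.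
Qed.

Lemma standard_normal_mgf_sqr_le (X : {RV P >-> R}) (m s sigma : R) :
  standard_normal X -> `|s * sigma ^+ 2| <= 1 / 4 ->
  (\int[P]_w (expR (s * (m + sigma * X w) ^+ 2))%:E <=
   (expR (s * (m ^+ 2 + sigma ^+ 2) +
          4 * s ^+ 2 * (sigma ^+ 4 + sigma ^+ 2 * m ^+ 2)))%:E)%E.
Proof.
move=> nX hs; rewrite (@standard_normal_ge0_integral X
  (fun x => expR (s * (m + sigma * x) ^+ 2)))//.
- exact: normal_mgf_sqr_le.
- exact: measurable_expR_sqr.
Qed.

(** The second moment is read off the moment generating function: integrating [1 + y <= expR y] at
    [y = s q] and at [y = - s q] pins the mean of [q] from both sides as [s] tends to 0. *)
Lemma standard_normal_integral_sqr (X : {RV P >-> R}) (m sigma : R) :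
  standard_normal X ->
  (\int[P]_w ((m + sigma * X w) ^+ 2)%:E = (m ^+ 2 + sigma ^+ 2)%:E)%E.
Proof.
move=> nX.
pose q w := (m + sigma * X w) ^+ 2.
have q0 w : 0 <= q w by exact: sqr_ge0.
have mq : measurable_fun setT q.
  by apply: measurable_funX; apply: measurable_funD => //; exact: measurable_funM.
have mexp s : measurable_fun setT (fun w => expR (s * q w)).
  by apply: measurableT_comp => //; exact: measurable_funM.
pose s0 : R := (4 * (1 + sigma ^+ 2))^-1.
have sg0 := sqr_ge0 sigma.
have s00 : 0 < s0 by rewrite invr_gt0; lra.
pose K := 4 * (sigma ^+ 4 + sigma ^+ 2 * m ^+ 2).
pose A := m ^+ 2 + sigma ^+ 2.
have hs s : 0 < s -> s <= s0 -> `|s * sigma ^+ 2| <= 1 / 4.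
  move=> sp ss0; rewrite ger0_norm; last by rewrite mulr_ge0// ltW.
  have : s * (4 * (1 + sigma ^+ 2)) <= 1.
    by rewrite -ler_pdivlMr ?div1r//; lra.
  lra.
have mgf (t : R) : `|t * sigma ^+ 2| <= 1 / 4 ->
    (\int[P]_w (expR (t * q w))%:E <= (expR (t * A + K * t ^+ 2))%:E)%E.
  move=> h; apply: (le_trans (standard_normal_mgf_sqr_le m nX h)).
  by rewrite lee_fin ler_expR /A /K; lra.
have int1 : (\int[P]_w (1 : R)%:E = 1)%E.
  by rewrite (integral_cst P measurableT) mul1e; exact: probability_setT.
have Hp s : 0 < s -> s <= s0 ->
    (1 + s%:E * \int[P]_w (q w)%:E <= (expR (s * A + K * s ^+ 2))%:E)%E.
  move=> sp ss0; apply: le_trans (mgf s (hs s sp ss0)).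
  rewrite -int1 -ge0_integralZl//; last 3 first.
  - exact/measurable_EFinP.
  - by move=> w _; rewrite lee_fin.
  - by rewrite lee_fin ltW.
  rewrite -ge0_integralD//; last 2 first.
  - by move=> w _; rewrite lee_fin mulr_ge0// ltW.
  - by apply/measurable_EFinP; exact: measurable_funM.
  apply: ge0_le_integral => //.
  - by move=> w _; rewrite lee_fin addr_ge0// mulr_ge0// ltW.
  - apply/measurable_EFinP; apply: measurable_funD => //.
    exact: measurable_funM.
  - exact/measurable_EFinP.
  - by move=> w _; rewrite lee_fin expR_ge1Dx.
(* Finiteness also follows from the exponential bound, at the single value [s0]. *)
have fq : (\int[P]_w (q w)%:E)%E \is a fin_num.
  rewrite ge0_fin_numE; last by apply: integral_ge0 => w _; rewrite lee_fin.
  have := Hp s0 s00 (lexx _).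
  have : (0 <= \int[P]_w (q w)%:E)%E by apply: integral_ge0 => w _; rewrite lee_fin.
  case: (\int[P]_w (q w)%:E)%E => [r _ _|_|//]; first exact: ltry.
  by rewrite gt0_muley ?lte_fin// addey.
rewrite -(fineK fq); congr EFin.
apply: (@eq_of_expR_quadratic_bounds _ _ A K s0) => //.
- by apply: fine_ge0; apply: integral_ge0 => w _; rewrite lee_fin.
- by rewrite /A addr_ge0// sqr_ge0.
- have -> : K = 4 * (sigma ^+ 2 * (sigma ^+ 2 + m ^+ 2)) by rewrite /K; ring.
  by rewrite mulr_ge0// mulr_ge0 ?addr_ge0 ?sqr_ge0.
- move=> s sp ss0; rewrite -lee_fin EFinD EFinM fineK//; exact: Hp.
- move=> s sp ss0; rewrite -lee_fin EFinD EFinM fineK//.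
  have hms : `|- s * sigma ^+ 2| <= 1 / 4 by rewrite mulNr normrN hs.
  have := mgf _ hms; rewrite sqrrN => h; apply: le_trans (leeD2r _ h).
  rewrite -int1 -ge0_integralZl//; last 3 first.
  - exact/measurable_EFinP.
  - by move=> w _; rewrite lee_fin.
  - by rewrite lee_fin ltW.
  rewrite -ge0_integralD//; last 3 first.
  - exact/measurable_EFinP.
  - by move=> w _; rewrite lee_fin mulr_ge0// ltW.
  - by apply/measurable_EFinP; exact: measurable_funM.
  apply: ge0_le_integral => //.
  - by apply/measurable_EFinP; apply: measurable_funD => //; exact: measurable_funM.
  - move=> w _; rewrite lee_fin -lerBlDr; apply: le_trans (expR_ge1Dx _).
    by rewrite mulNr.
Qed.

Variables (I : finType) (eps : I -> {RV P >-> R}).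
Hypothesis neps : forall i, standard_normal (eps i).

Lemma measurable_gaussian_quadratic (m sigma : I -> R) :
  measurable_fun setT (fun w => \sum_i (m i + sigma i * eps i w) ^+ 2).
Proof.
apply: measurable_sum => i.
by apply: measurable_funX; apply: measurable_funD => //; exact: measurable_funM.
Qed.

Lemma expectation_gaussian_quadratic (m sigma : I -> R) :
  ('E_P[fun w => (\sum_i (m i + sigma i * eps i w) ^+ 2)%R] =
   (\sum_i (m i ^+ 2 + sigma i ^+ 2))%:E)%E.
Proof.
rewrite unlock; under eq_integral do rewrite -sumEFin.
rewrite ge0_integral_sum//; last 2 first.
- move=> i; apply/measurable_EFinP; apply: measurable_funX.
  by apply: measurable_funD => //; exact: measurable_funM.
- by move=> i w _; rewrite lee_fin sqr_ge0.
by rewrite -sumEFin; apply: eq_bigr => i _; exact: standard_normal_integral_sqr.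
Qed.

(** Chernoff's bound: the indicator of the event is at most [expR (Q - z)], whose expectation
    factorizes by independence. A positive [s] gives the upper tail of the quadratic form, a
    negative one the lower tail. *)
Lemma gaussian_quadratic_tail (m sigma : I -> R) (s z : R) :
  mutually_independent eps -> (forall i, `|s * sigma i ^+ 2| <= 1 / 4) ->
  (P [set w | (z <= s * \sum_i (m i + sigma i * eps i w) ^+ 2)%R] <=
   (expR (s * (\sum_i (m i ^+ 2 + sigma i ^+ 2)) +
     4 * s ^+ 2 * (\sum_i (sigma i ^+ 4 + sigma i ^+ 2 * m i ^+ 2)) - z))%:E)%E.
Proof.
move=> ind hs.
pose f i x := expR (s * (m i + sigma i * x) ^+ 2).
have mf i : measurable_fun setT (f i) by exact: measurable_expR_sqr.
pose Q w := s * \sum_i (m i + sigma i * eps i w) ^+ 2.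
have QE w : expR (Q w) = \prod_i f i (eps i w).
  by rewrite /Q mulr_sumr expR_sum.
have mQ : measurable_fun setT Q.
  by apply: measurable_funM => //; exact: measurable_gaussian_quadratic.
pose e i := fine (\int[P]_w (f i (eps i w))%:E)%E.
have bnd i := standard_normal_mgf_sqr_le (m i) (neps i) (hs i).
have fe i : (\int[P]_w (f i (eps i w))%:E = (e i)%:E)%E.
  rewrite /e fineK// ge0_fin_numE; first exact: le_lt_trans (bnd i) (ltry _).
  by apply: integral_ge0 => w _; rewrite lee_fin expR_ge0.
have f0 i x : 0 <= f i x by exact: expR_ge0.
have := indep_expectation_prod ind mf f0 fe => prodE.
have mA : measurable [set w | z <= Q w].
  by rewrite -[X in measurable X]setTI; exact: measurable_fun_le.
have -> : P [set w | z <= Q w] = (\int[P]_w (\1_[set w | z <= Q w] w)%:E)%E.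
  by rewrite integral_indic// setIT.
apply: (@le_trans _ _ (\int[P]_w ((expR (- z))%:E * (expR (Q w))%:E))%E).
  apply: ge0_le_integral => //.
  - exact/measurable_EFinP/measurable_indic.
  - apply: emeasurable_funM => //; apply/measurable_EFinP.
    exact: measurableT_comp.
  - move=> w _; rewrite -EFinM -expRD lee_fin indicE.
    have [|_] := boolP (w \in _); last exact: expR_ge0.
    by rewrite inE/= => zQ; rewrite -expR0 ler_expR addrC subr_ge0.
rewrite ge0_integralZl//; last first.
  by apply/measurable_EFinP; exact: measurableT_comp.
under eq_integral do rewrite QE.
rewrite prodE -EFinM lee_fin addrC expRD ler_wpM2l ?expR_ge0//.
rewrite !mulr_sumr -big_split/= expR_sum; apply: ler_prod => i _.
rewrite -!lee_fin -fe bnd andbT.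
by apply: integral_ge0 => w _; rewrite lee_fin.
Qed.

End GaussianQuadratic.

(** * First passage times and filters *)

Section FirstPassage.
Variables (R : realType) (F : R -> R) (a kappa : R).
Hypothesis Fc : {within `[a, +oo[, continuous F}.
Hypothesis Fdec : forall s t, a <= s -> s <= t -> F t <= F s.
Hypothesis Fex : exists2 t, a <= t & F t <= kappa.

Let tau := inf [set t | a <= t /\ F t <= kappa].

Lemma first_passage_ivt b c v : a <= b -> b <= c -> F c <= v <= F b ->
  exists2 t, b <= t <= c & F t = v.
Proof.
move=> ab bc Fv; have [|||t] := @IVT R F b c v => //.
- apply: continuous_subspaceW Fc => x /=; rewrite !in_itv/= andbT => /andP[bx _].
  exact: le_trans bx.
- by rewrite min_r ?max_l ?Fdec.
- by rewrite in_itv/=; exists t.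
Qed.

Let S0 : [set t | a <= t /\ F t <= kappa] !=set0.
Proof. by have [t ? ?] := Fex; exists t. Qed.

Let Slb : lbound [set t | a <= t /\ F t <= kappa] a.
Proof. by move=> t []. Qed.

Let Shl : has_lbound [set t | a <= t /\ F t <= kappa].
Proof. by exists a. Qed.

Lemma first_passage_ge : a <= tau.
Proof. exact: lb_le_inf. Qed.

(** Were [F tau] above [kappa], some [c > tau] would have [F c] halfway between the two. The infimum
    is approached by points of the set below [c], and monotonicity would force [F c <= kappa]. *)
Lemma first_passage_le : F tau <= kappa.
Proof.
rewrite leNgt; apply/negP => Ftau; have [t1 at1 Ft1] := Fex.
have taut1 : tau <= t1 by apply: ge_inf.
have [|c /andP[tauc ct1] Fcv] :=
  @first_passage_ivt tau t1 ((F tau + kappa) / 2) first_passage_ge taut1.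
  by apply/andP; split; lra.
have tauNc : tau < c.
  by rewrite lt_neqAle tauc andbT; apply/eqP => e; move: Fcv; rewrite -e; lra.
have [|t [at_ Ft] ttau] :=
  @inf_adherent R [set t | a <= t /\ F t <= kappa] (c - tau) _ (conj S0 Shl).
  by rewrite subr_gt0.
move: ttau; rewrite -/tau addrC subrK => tc.
have := Fdec at_ (ltW tc); lra.
Qed.

(** This trades an event about the passage time for one about [F] at a fixed time. It makes the
    stopping time measurable and reduces its deviations to deterministic times. *)
Lemma first_passageP t : a <= t -> (F t <= kappa) = (tau <= t).
Proof.
move=> at_; apply/idP/idP => [Ft|taut]; first exact: ge_inf.
exact: le_trans (Fdec first_passage_ge taut) first_passage_le.
Qed.

Lemma first_passage_eq : a < tau -> F tau = kappa.
Proof.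
move=> atau; apply/eqP; rewrite eq_le first_passage_le/=.
have Fa : kappa < F a by rewrite ltNge first_passageP// -ltNge.
have [|c /andP[ac ctau] Fck] :=
  @first_passage_ivt a tau kappa (lexx _) first_passage_ge.
  by rewrite first_passage_le ltW.
rewrite -Fck; apply: Fdec first_passage_ge _.
by rewrite -first_passageP// Fck.
Qed.

End FirstPassage.

Section Filters.
Variables (R : realType) (D : nat) (gamma : 'I_D -> R -> R).
Hypothesis sf : forall i, spectral_filter (gamma i).
Implicit Types (w : 'I_D -> R) (t : R).

(** The free weight lets one set of lemmas serve all these sums: [Y_i^2] gives the residual,
    [mu_i^2] the strong squared bias, [lambda_i^2 mu_i^2] the weak one, and the latter plus
    [delta^2] the expected residual. *)
Definition filter_residual w t := \sum_(i < D) (1 - gamma i t) ^+ 2 * w i.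
Definition filter_energy w t := \sum_(i < D) gamma i t ^+ 2 * w i.

Lemma spectral_filter_itv i t : 0 <= t -> 0 <= gamma i t <= 1.
Proof. by have [] := sf i => + _ _ _ _; exact. Qed.

Lemma filter_residual_le w s t : (forall i, 0 <= w i) -> 0 <= s -> s <= t ->
  filter_residual w t <= filter_residual w s.
Proof.
move=> w0 s0 st; apply: ler_sum => i _; rewrite ler_wpM2r//.
have /andP[? ?] := spectral_filter_itv i s0.
have /andP[? ?] := spectral_filter_itv i (le_trans s0 st).
have [_ _ /(_ s t s0 st) ? _ _] := sf i.
by rewrite ler_pXn2r ?nnegrE//; lra.
Qed.

Lemma filter_energy_le w s t : (forall i, 0 <= w i) -> 0 <= s -> s <= t ->
  filter_energy w s <= filter_energy w t.
Proof.
move=> w0 s0 st; apply: ler_sum => i _; rewrite ler_wpM2r//.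
have /andP[? ?] := spectral_filter_itv i s0.
have /andP[? ?] := spectral_filter_itv i (le_trans s0 st).
have [_ _ /(_ s t s0 st) ? _ _] := sf i.
by rewrite ler_pXn2r ?nnegrE//; lra.
Qed.

Lemma filter_residual_ge0 w t : (forall i, 0 <= w i) -> 0 <= filter_residual w t.
Proof. by move=> w0; apply: sumr_ge0 => i _; rewrite mulr_ge0// sqr_ge0. Qed.

Lemma filter_energy_ge0 w t : (forall i, 0 <= w i) -> 0 <= filter_energy w t.
Proof. by move=> w0; apply: sumr_ge0 => i _; rewrite mulr_ge0// sqr_ge0. Qed.

Lemma filter_residual_continuous w :
  {within `[0, +oo[, continuous (filter_residual w)}.
Proof.
apply: continuous_big => [|i _ x]; first exact: add_continuous.
have [_ gc _ _ _] := sf i.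
apply: cvgM; last exact: cvg_cst.
by rewrite expr2; apply: cvgM; (apply: cvgB; [exact: cvg_cst|exact: gc]).
Qed.

Lemma filter_energy_continuous w :
  {within `[0, +oo[, continuous (filter_energy w)}.
Proof.
apply: continuous_big => [|i _ x]; first exact: add_continuous.
have [_ gc _ _ _] := sf i.
apply: cvgM; last exact: cvg_cst.
by rewrite expr2; apply: cvgM; exact: gc.
Qed.

Lemma filter_residual_cvg w : filter_residual w t @[t --> +oo] --> 0.
Proof.
have -> : 0 = \sum_(i < D) (1 - 1) ^+ 2 * w i.
  by rewrite big1// => i _; rewrite subrr expr0n mul0r.
apply: cvg_big => [|i _]; first exact: add_continuous.
have [_ _ _ _ gc] := sf i.
apply: cvgM; last exact: cvg_cst.
by rewrite expr2; apply: cvgM; (apply: cvgB; [exact: cvg_cst|exact: gc]).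
Qed.

Lemma filter_energy_cvg w : filter_energy w t @[t --> +oo] --> \sum_i w i.
Proof.
have -> : \sum_i w i = \sum_(i < D) 1 ^+ 2 * w i.
  by apply: eq_bigr => i _; rewrite expr1n mul1r.
apply: cvg_big => [|i _]; first exact: add_continuous.
have [_ _ _ _ gc] := sf i.
apply: cvgM; last exact: cvg_cst.
by rewrite expr2; apply: cvgM; exact: gc.
Qed.

Lemma filter_residual_small w a c : 0 < c ->
  exists2 t, a <= t & filter_residual w t <= c.
Proof.
move=> c0; have /cvgr_lt/(_ c c0) H := filter_residual_cvg w.
near (+oo : set_system R) => t; exists t.
  by near: t; apply: nbhs_pinfty_ge; exact: num_real.
by apply: ltW; near: t.
Unshelve. all: by end_near. Qed.

Lemma filter_energy_large w a c : c < \sum_i w i ->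
  exists2 t, a <= t & c <= filter_energy w t.
Proof.
move=> cw; have /cvgr_gt/(_ c cw) H := @filter_energy_cvg w.
near (+oo : set_system R) => t; exists t.
  by near: t; apply: nbhs_pinfty_ge; exact: num_real.
by apply: ltW; near: t.
Unshelve. all: by end_near. Qed.

End Filters.

(** * Uniform control of the noise *)

Lemma abel_sum_le (R : realType) (g c : nat -> R) (y : R) (n : nat) :
  0 <= y ->
  (forall k, (k.+1 < n)%N -> g k.+1 <= g k) ->
  (forall k, (k < n)%N -> 0 <= g k <= 1) ->
  (forall k, (k < n)%N -> \sum_(i < k.+1) c i <= y) ->
  \sum_(i < n) g i * c i <= y.
Proof.
move=> y0 gd g01 cy.
case: n => [|n] in gd g01 cy *; first by rewrite big_ord0.
(* Abel summation as an invariant: passing from [k] to [k.+1] gains [(g k - g k.+1) * (y - C) >= 0],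
   with [C] the partial sum up to [k]. The signs of the [c i] do not matter. *)
suff H k : (k <= n)%N ->
    \sum_(i < k.+1) g i * c i <= (1 - g k) * y + g k * \sum_(i < k.+1) c i.
  apply: (le_trans (H n (leqnn n))).
  have /andP[gn0 gn1] := g01 n (ltnSn n).
  have := ler_wpM2l gn0 (cy n (ltnSn n)); lra.
elim: k => [_|k IH kn].
  rewrite !big_ord1; have /andP[? ?] := g01 0%N isT; nra.
rewrite big_ord_recr/= [in leRHS]big_ord_recr/=.
have := IH (ltnW kn); set C := \sum_(i < k.+1) c i => Hk.
have Cy : C <= y by apply: cy; exact: ltnW.
have gk : g k.+1 <= g k by apply: gd.
nra.
Qed.

Lemma sum_antitone_weight_le (R : realType) (D : nat) (g c : 'I_D -> R) (y : R) :
  0 <= y ->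
  (forall i j : 'I_D, (i <= j)%N -> g j <= g i) ->
  (forall i, 0 <= g i <= 1) ->
  (forall k : 'I_D, \sum_(i < D | (i <= k)%N) c i <= y) ->
  \sum_i g i * c i <= y.
Proof.
move=> y0 gd g01 cy.
pose ext (f : 'I_D -> R) k := oapp f 0 (insub k).
have extE f (i : 'I_D) : ext f i = f i by rewrite /ext valK.
have extE' f k (kD : (k < D)%N) : ext f k = f (Ordinal kD).
  by rewrite -extE.
under eq_bigr do rewrite -(extE g) -(extE c).
apply: (abel_sum_le (g := ext g) (c := ext c)) => // k kD.
- by rewrite (extE' _ _ kD) (extE' _ _ (ltnW kD)); apply: gd => /=.
- by rewrite (extE' _ _ kD).
- have := cy (Ordinal kD); rewrite /= => /(le_trans _); apply.
  rewrite (big_ord_widen D (ext c))//.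
  by under [leLHS]eq_bigr do rewrite extE.
Qed.

(** Telescoping: [1 + c <= expR c] bounds [c] times each term by the difference of two consecutive
    exponentials. The bound is free of [n], which keeps the final constants independent of the
    dimension. *)
Lemma sum_expR_geometric_le (R : realType) (c : R) (n : nat) : 0 < c ->
  \sum_(k < n) expR (- (c * k.+1%:R)) <= c^-1.
Proof.
move=> c0; rewrite -[leRHS]mulr1 ler_pdivlMl//.
suff : c * \sum_(k < n) expR (- (c * k.+1%:R)) <= 1 - expR (- (c * n%:R)).
  by move/le_trans; apply; rewrite gerBl expR_ge0.
elim: n => [|n IH].
  by rewrite big_ord0 !mulr0 oppr0 expR0 subrr.
rewrite big_ord_recr/= mulrDr.
have e : expR (- (c * n%:R)) = expR c * expR (- (c * n.+1%:R)).
  by rewrite -expRD -natr1; congr expR; ring.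
have := expR_ge1Dx c; have := expR_ge0 (- (c * n.+1%:R)).
rewrite e in IH; nra.
Qed.

Lemma entryE (R : realType) (D : nat) (v : 'I_D -> R) (j : 'I_D) (k : nat) :
  k.-1 = j -> entry v k = v j.
Proof.
move=> kj; rewrite /entry kj codomE (nth_map j) ?size_enum_ord//.
by rewrite nth_ord_enum.
Qed.

Section NoiseSums.
Context d (T : measurableType d) (R : realType) (P : probability T R).
Variables (D : nat) (eps : 'I_D -> {RV P >-> R}) (lambda : 'I_D -> R).
Hypotheses (ind : mutually_independent eps).
Hypotheses (neps : forall i, standard_normal (eps i)).
Hypothesis lambda0 : forall i, 0 < lambda i.
Hypothesis lambdad : forall i j : 'I_D, (i <= j)%N -> lambda j <= lambda i.

Definition noise_event (k : 'I_D) (y : R) := [set w |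
  2 * (\sum_(i < D | (i <= k)%N) lambda i ^- 2) + y <=
  \sum_(i < D | (i <= k)%N) lambda i ^- 2 * eps i w ^+ 2].

Lemma measurable_noise_event k y : measurable (noise_event k y).
Proof.
rewrite -[X in measurable X]setTI; apply: measurable_fun_le => //.
under eq_fun do rewrite -big_filter.
apply: measurable_sum => i; apply: measurable_funM => //.
exact: measurable_funX.
Qed.

Lemma inv_sqr_antitone (i j : 'I_D) : (i <= j)%N -> lambda i ^- 2 <= lambda j ^- 2.
Proof.
move=> ij; rewrite lef_pV2 ?posrE ?exprn_gt0//.
by rewrite ler_pXn2r ?nnegrE ?(ltW (lambda0 _))// lambdad.
Qed.

(** Chernoff with [s = 1 / (8 lambda_j^-2)]: then [s lambda_i^-2 <= 1/8] for [i <= k <= j], so the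
    quadratic term costs half of the spare mean in [noise_event] and the other half stays in the
    exponent. The index [j] is left free since two choices are needed. *)
Lemma noise_event_le (k j : 'I_D) (y : R) : (k <= j)%N ->
  (P (noise_event k y) <=
   (expR (- ((8 * lambda j ^- 2)^-1 *
     (2^-1 * (\sum_(i < D | (i <= k)%N) lambda i ^- 2) + y))))%:E)%E.
Proof.
move=> kj; set s := (8 * lambda j ^- 2)^-1.
have aj0 : 0 < lambda j ^- 2 by rewrite invr_gt0 exprn_gt0.
have s0 : 0 < s by rewrite invr_gt0 mulr_gt0.
pose sg (i : 'I_D) := if (i <= k)%N then (lambda i)^-1 else 0.
have sg2 i : sg i ^+ 2 = if (i <= k)%N then lambda i ^- 2 else 0.
  by rewrite /sg; case: ifP => _; rewrite ?exprVn ?expr0n.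
have sa (i : 'I_D) : (i <= k)%N -> s * lambda i ^- 2 <= 8^-1.
  move=> ik; rewrite mulrC ler_pdivrMr ?mulr_gt0// mulKf//.
  exact/inv_sqr_antitone/(leq_trans ik).
have hs i : `|s * sg i ^+ 2| <= 1 / 4.
  rewrite sg2; case: ifP => [ik|_]; last by rewrite mulr0 normr0.
  rewrite ger0_norm; last by rewrite mulr_ge0 ?(ltW s0)// invr_ge0 sqr_ge0.
  have := sa i ik; lra.
set A := \sum_(i < D | (i <= k)%N) lambda i ^- 2.
have qE w : \sum_i (0 + sg i * eps i w) ^+ 2 =
    \sum_(i < D | (i <= k)%N) lambda i ^- 2 * eps i w ^+ 2.
  rewrite [RHS]big_mkcond; apply: eq_bigr => i _.
  by rewrite add0r exprMn sg2; case: ifP => //; rewrite mul0r.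
have -> : noise_event k y = [set w | (s * (2 * A + y) <=
    s * \sum_i (0 + sg i * eps i w) ^+ 2)%R].
  by apply/seteqP; split => w /=; rewrite qE ler_pM2l.
apply: le_trans (gaussian_quadratic_tail neps (fun=> 0) _ ind hs) _.
have -> : \sum_i ((0 : R) ^+ 2 + sg i ^+ 2) = A.
  by rewrite /A [RHS]big_mkcond; apply: eq_bigr => i _; rewrite expr0n add0r sg2.
have B : 4 * s ^+ 2 * (\sum_i (sg i ^+ 4 + sg i ^+ 2 * (0 : R) ^+ 2)) <=
    2^-1 * s * A.
  rewrite /A [X in _ <= _ * X]big_mkcond !mulr_sumr; apply: ler_sum => i _.
  rewrite expr0n mulr0 addr0 (exprM _ 2 2) sg2.
  case: ifP => [ik|_]; last by rewrite expr0n !mulr0.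
  have sai := sa i ik.
  have a0 : 0 <= s * lambda i ^- 2.
    by rewrite mulr_ge0 ?(ltW s0)// invr_ge0 sqr_ge0.
  move: sai a0; set a := lambda i ^- 2; nra.
rewrite lee_fin ler_expR; lra.
Qed.

(** With [k0] the truncated index, short sums ([k < k0]) use [j = k0 - 1]: the term in [y] gives
    [x / 8] and [k + 1 <= x]. Long sums use [j = k]: by (iv) the remaining half mean gives at least
    [cl^2 (k + 1) / 16], and [x <= k + 1]. The factor in [k] makes the union bound summable. *)
Lemma noise_event_uniform_le (cl c2 x : R) (k : 'I_D) :
  0 < cl -> 0 < c2 -> c2 <= 1 / 16 -> c2 <= cl ^+ 2 / 32 -> 1 <= x ->
  cl ^+ 2 * lambda k ^- 2 <=
    (k.+1%:R)^-1 * \sum_(i < D | (i <= k)%N) lambda i ^- 2 ->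
  (P (noise_event k (x * entry lambda (minn (Num.truncn x) D) ^- 2)) <=
   (expR (- (c2 * x)) * expR (- (c2 * k.+1%:R)))%:E)%E.
Proof.
move=> cl0 c20 c2a c2b x1 hk.
have D0 : (0 < D)%N := leq_ltn_trans (leq0n k) (ltn_ord k).
have k0x : (0 < Num.truncn x)%N by rewrite truncn_gt0.
set k0 := minn (Num.truncn x) D.
have k00 : (0 < k0)%N by rewrite leq_min k0x.
have k0D : (k0.-1 < D)%N by rewrite prednK// geq_minr.
rewrite (@entryE _ _ _ (Ordinal k0D))//.
set j := Ordinal k0D.
have aj0 i : 0 < lambda i ^- 2 by rewrite invr_gt0 exprn_gt0.
set A := \sum_(i < D | (i <= k)%N) lambda i ^- 2 in hk.
have A0 : 0 <= A by apply: sumr_ge0 => i _; exact: ltW.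
rewrite -expRD -opprD -mulrDr.
have [kj|jk] := leqP k j.
- apply: (le_trans (noise_event_le _ kj)); rewrite lee_fin ler_expR lerN2.
  rewrite -/A; have := aj0 j; set a := lambda j ^- 2 => a0.
  have -> : (8 * a)^-1 * (2^-1 * A + x * a) = (8 * a)^-1 * (2^-1 * A) + x / 8.
    by field; exact: lt0r_neq0.
  have kx : k.+1%:R <= x.
    apply: (@le_trans _ _ (Num.truncn x)%:R); last first.
      by rewrite truncn_le (le_trans ler01).
    rewrite ler_nat; apply: leq_trans (geq_minl _ D).
    by rewrite -/k0 -(prednK k00) ltnS.
  apply: (@le_trans _ _ (x / 8)).
    have := ler_wpM2r (addr_ge0 (le_trans ler01 x1) (ler0n R k.+1)) c2a; lra.
  by rewrite lerDr !mulr_ge0// invr_ge0 mulr_ge0// ltW.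
- apply: (le_trans (noise_event_le _ (leqnn k))); rewrite lee_fin ler_expR lerN2.
  (* As [k < D], the minimum defining [k0] cannot be [D] in this case, so [k] is at least the
     truncation of [x]. *)
  have xk : x <= k.+1%:R.
    apply: ltW; apply: (lt_le_trans (truncnS_gt x)).
    rewrite ler_nat ltnS.
    move: jk (ltn_ord k); rewrite /j /= /k0.
    move: (Num.truncn x) (nat_of_ord k) => t k'; clear.
    lia.
  rewrite -/A invfM [leRHS]mulrDr -[leLHS]addr0; apply: lerD; last first.
    have x0 : 0 <= x by lra.
    apply: mulr_ge0; last by apply: mulr_ge0 => //; exact: ltW.
    by apply: mulr_ge0; rewrite invr_ge0 // ltW.
  have kpos : 0 < k.+1%:R :> R by rewrite ltr0n.
  have : (cl ^+ 2 / 32) * (k.+1%:R + k.+1%:R) <=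
      8^-1 * (lambda k ^- 2)^-1 * (2^-1 * A).
    rewrite ler_pdivlMl// in hk.
    rewrite [leRHS](_ : _ = (16^-1 * A) / (lambda k ^- 2)); last first.
      by field; exact: lt0r_neq0.
    rewrite ler_pdivlMr//; lra.
  apply: le_trans; apply: ler_pM => //; first exact: ltW.
    by rewrite addr_ge0// (le_trans ler01).
  by rewrite lerD2r.
Qed.

(** Off the noise events every partial sum of the centred terms is at most [y], so Abel summation
    applies to any antitone weights. Being pathwise in [w], the bound may be used with the filter at
    a random time. *)
Lemma weighted_noise_le (x : R) (g : 'I_D -> R) (w : T) :
  let y := x * entry lambda (minn (Num.truncn x) D) ^- 2 in
  0 <= x -> (forall i j : 'I_D, (i <= j)%N -> g j <= g i) ->
  (forall i, 0 <= g i <= 1) ->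
  (forall k, ~ noise_event k y w) ->
  \sum_i g i ^+ 2 * (lambda i ^- 2 * eps i w ^+ 2) <=
  2 * (\sum_i g i ^+ 2 * lambda i ^- 2) + y.
Proof.
move=> y x0 gd g01 nE.
have y0 : 0 <= y by rewrite mulr_ge0// invr_ge0 sqr_ge0.
rewrite -lerBlDl mulr_sumr -sumrB.
rewrite (eq_bigr (fun i => g i ^+ 2 *
  (lambda i ^- 2 * eps i w ^+ 2 - 2 * lambda i ^- 2))); last by move=> i _; ring.
apply: sum_antitone_weight_le => //.
- move=> i j ij; have /andP[? ?] := g01 i; have /andP[? ?] := g01 j.
  by rewrite ler_pXn2r ?nnegrE// gd.
- move=> i; have /andP[? ?] := g01 i.
  by rewrite exprn_ge0//= exprn_ile1.
- move=> k; rewrite sumrB -mulr_sumr lerBlDl.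
  by have /negP := nE k; rewrite -ltNge => /ltW.
Qed.

End NoiseSums.

(** * Stopping time against oracle time *)

(** Symmetrizing in [i] and [j], twice the difference is a sum of
    [(u_i v_j - u_j v_i) (l_i - l_j) w_i w_j], whose terms are nonnegative as both brackets have the
    same sign. The monotone ratio [u / v] is cross-multiplied so that [v] may vanish. *)
Lemma chebyshev_sum_le (R : realDomainType) (D : nat) (u v w l : 'I_D -> R) :
  (forall i, 0 <= w i) ->
  (forall i j : 'I_D, (i <= j)%N -> l j <= l i) ->
  (forall i j : 'I_D, (i <= j)%N -> u j * v i <= u i * v j) ->
  (\sum_i u i * w i) * (\sum_i v i * (l i * w i)) <=
  (\sum_i u i * (l i * w i)) * (\sum_i v i * w i).
Proof.
move=> w0 ld uv; rewrite -subr_ge0 !big_distrlr/= -sumrB.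
under eq_bigr do rewrite -sumrB.
set S := \sum_i _.
have S2 : S + S = \sum_i \sum_j (u i * v j - u j * v i) * (l i - l j) * (w i * w j).
  rewrite {2}/S exchange_big/= -big_split/=; apply: eq_bigr => i _.
  by rewrite -big_split/=; apply: eq_bigr => j _; ring.
suff : 0 <= S + S by lra.
rewrite S2; apply: sumr_ge0 => i _; apply: sumr_ge0 => j _.
apply: mulr_ge0; last by rewrite mulr_ge0.
have [ij|/ltnW ji] := leqP i j.
- by rewrite mulr_ge0// subr_ge0 ?ld ?uv.
- by rewrite mulr_le0// subr_le0 ?ld ?uv.
Qed.

Section Model.
Context d (T : measurableType d) (R : realType) (P : probability T R).
Variables (D : nat) (delta : R) (lambda : 'I_D -> R) (mu : 'rV[R]_D).
Variables (gamma : 'I_D -> R -> R) (kappa t0 : R) (eps : 'I_D -> {RV P >-> R}).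
Hypothesis delta0 : 0 < delta.
Hypothesis ind : mutually_independent eps.
Hypothesis neps : forall i, standard_normal (eps i).
Hypothesis sf : forall i, spectral_filter (gamma i).
Hypothesis kappa0 : 0 < kappa.
Hypothesis t00 : 0 <= t0.

Let Y := fun w : T => observation lambda mu delta (fun i => eps i w).
Let tau := fun w : T => stopping_time gamma t0 kappa (Y w).
Let tstar := oracle_time P gamma t0 kappa Y.
Let Vl := weak_variance gamma delta.
Let wl i := lambda i ^+ 2 * mu 0 i ^+ 2.
Let BW := filter_residual gamma wl.
Let ER := filter_residual gamma (fun i => wl i + delta ^+ 2).

Let wl0 i : 0 <= wl i. Proof. by rewrite mulr_ge0// sqr_ge0. Qed.
Let we0 i : 0 <= wl i + delta ^+ 2. Proof. by rewrite addr_ge0// sqr_ge0. Qed.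

Lemma weak_bias_sqr t : weak_bias gamma lambda mu t ^+ 2 = BW t.
Proof.
rewrite sqr_sqrtr.
  by apply: eq_bigr => i _; rewrite /wl; ring.
by apply: sumr_ge0 => i _; rewrite mulr_ge0 ?sqr_ge0// mulr_ge0 ?sqr_ge0.
Qed.

Lemma residual2_gaussian t w : residual2 gamma (Y w) t =
  \sum_i ((1 - gamma i t) * (lambda i * mu 0 i) +
          (1 - gamma i t) * delta * eps i w) ^+ 2.
Proof. by apply: eq_bigr => i _; rewrite mxE; ring. Qed.

Lemma expected_residual_sumE t : ER t =
  \sum_i (((1 - gamma i t) * (lambda i * mu 0 i)) ^+ 2 +
          ((1 - gamma i t) * delta) ^+ 2).
Proof. by apply: eq_bigr => i _; rewrite /wl; ring. Qed.

Lemma expectation_residual2 t :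
  ('E_P[fun w => residual2 gamma (Y w) t] = (ER t)%:E)%E.
Proof.
rewrite expected_residual_sumE -(expectation_gaussian_quadratic neps).
by congr expectation; apply/funext => w; exact: residual2_gaussian.
Qed.

Lemma measurable_residual2 t :
  measurable_fun setT (fun w => residual2 gamma (Y w) t).
Proof.
under eq_fun do rewrite residual2_gaussian.
exact: measurable_gaussian_quadratic.
Qed.

Lemma residual_passage_hyps (w : 'I_D -> R) : (forall i, 0 <= w i) ->
  [/\ {within `[t0, +oo[, continuous (filter_residual gamma w)},
     forall s t, t0 <= s -> s <= t ->
       filter_residual gamma w t <= filter_residual gamma w s
   & exists2 t, t0 <= t & filter_residual gamma w t <= kappa].
Proof.
move=> w0; split.
- apply: continuous_subspaceW (filter_residual_continuous sf (w := w)) => x /=.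
  by rewrite !in_itv/= !andbT; exact: le_trans.
- by move=> s t ts; apply: filter_residual_le => //; exact: le_trans ts.
- exact: filter_residual_small.
Qed.

Lemma oracle_timeE : tstar = inf [set t | t0 <= t /\ ER t <= kappa].
Proof.
rewrite /tstar /oracle_time; congr inf; apply/seteqP; split => t /=;
  by rewrite expectation_residual2 lee_fin.
Qed.

Lemma oracle_time_ge : t0 <= tstar.
Proof.
by rewrite oracle_timeE; have [? ? ?] := residual_passage_hyps we0;
  exact: first_passage_ge.
Qed.

Lemma oracle_time_le : ER tstar <= kappa.
Proof.
by rewrite oracle_timeE; have [? ? ?] := residual_passage_hyps we0;
  exact: first_passage_le.
Qed.

Lemma oracle_time_eq : t0 < tstar -> ER tstar = kappa.
Proof.
by rewrite oracle_timeE; have [? ? ?] := residual_passage_hyps we0;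
  exact: first_passage_eq.
Qed.

Lemma stopping_time_ge w : t0 <= tau w.
Proof.
have [|? ? ?] := @residual_passage_hyps (fun i => Y w 0 i ^+ 2).
  by move=> i; exact: sqr_ge0.
exact: first_passage_ge.
Qed.

Lemma stopping_timeP w t : t0 <= t ->
  (residual2 gamma (Y w) t <= kappa) = (tau w <= t).
Proof.
move=> t0t; have [|? ? ?] := @residual_passage_hyps (fun i => Y w 0 i ^+ 2).
  by move=> i; exact: sqr_ge0.
exact: (@first_passageP _ (filter_residual gamma (fun i => Y w 0 i ^+ 2))).
Qed.

Lemma measurable_stopping_time : measurable_fun setT tau.
Proof.
apply: (measurability _ (@RGenOInfty.measurableE R)) => _ [_ [r ->] <-].
rewrite setTI; have [rt0|t0r] := ltP r t0.
  rewrite (_ : _ @^-1` _ = setT)//; apply/seteqP; split => w //= _.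
  by rewrite in_itv/= andbT (lt_le_trans rt0)// stopping_time_ge.
rewrite (_ : _ @^-1` _ = ~` [set w | residual2 gamma (Y w) r <= kappa]).
  apply: measurableC; rewrite -[X in measurable X]setTI.
  by apply: measurable_fun_le => //; exact: measurable_residual2.
apply/seteqP; split => w /=; rewrite in_itv/= andbT stopping_timeP//.
  by rewrite ltNge => /negP.
by rewrite ltNge => /negP.
Qed.

Lemma residual_proxy_le t : 0 <= t ->
  \sum_i (((1 - gamma i t) * delta) ^+ 4 +
          ((1 - gamma i t) * delta) ^+ 2 *
          ((1 - gamma i t) * (lambda i * mu 0 i)) ^+ 2) <=
  D%:R * delta ^+ 4 + delta ^+ 2 * BW t.
Proof.
move=> tt; rewrite big_split/= /BW mulr_sumr; apply: lerD; last first.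
  apply: ler_sum => i _; have /andP[g0 g1] := spectral_filter_itv sf i tt.
  have -> : ((1 - gamma i t) * delta) ^+ 2 *
      ((1 - gamma i t) * (lambda i * mu 0 i)) ^+ 2 =
      (1 - gamma i t) ^+ 2 * (delta ^+ 2 * ((1 - gamma i t) ^+ 2 * wl i)).
    by rewrite /wl; ring.
  rewrite ler_piMl ?exprn_ile1 ?subr_ge0 ?lerBlDr ?lerDl//.
  by rewrite mulr_ge0 ?sqr_ge0// mulr_ge0 ?sqr_ge0.
rewrite -[D in leRHS]card_ord mulr_natl -sumr_const; apply: ler_sum => i _.
have /andP[g0 g1] := spectral_filter_itv sf i tt.
rewrite exprMn ler_piMl ?exprn_ile1 ?subr_ge0 ?lerBlDr ?lerDl//.
by rewrite exprn_ge0// ltW.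
Qed.

Lemma residual_weight_le t s c i : 0 <= t -> `|s| * delta ^+ 2 <= c ->
  `|s * ((1 - gamma i t) * delta) ^+ 2| <= c.
Proof.
move=> tt; apply: le_trans.
have /andP[g0 g1] := spectral_filter_itv sf i tt.
rewrite normrM ler_wpM2l// ger0_norm ?sqr_ge0// exprMn.
by rewrite ler_piMl ?sqr_ge0// exprn_ile1 ?subr_ge0 ?lerBlDr ?lerDl.
Qed.

(** Chernoff at [s = - x / BW t]: the gap [BW t / 2] between mean and threshold contributes
    [- x / 2], and the two lower bounds on [BW t] keep the quadratic term below [x / 4]. *)
Lemma residual_lower_tail (t x : R) : 0 <= t -> 1 <= x ->
  8 * x * Num.sqrt D%:R * delta ^+ 2 <= BW t -> 24 * x * delta ^+ 2 <= BW t ->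
  kappa <= ER t - BW t / 2 ->
  (P [set w | (residual2 gamma (Y w) t <= kappa)%R] <=
   (expR (- (x / 4)))%:E)%E.
Proof.
move=> tt x1 B1 B2 hk.
have d20 : 0 < delta ^+ 2 by rewrite exprn_gt0.
have B0 : 0 < BW t by apply: lt_le_trans B2; rewrite !mulr_gt0//; lra.
pose s := - (x / BW t).
have sneg : s < 0 by rewrite oppr_lt0 divr_gt0//; lra.
have -> : [set w | (residual2 gamma (Y w) t <= kappa)%R] =
    [set w | s * kappa <= s * \sum_i ((1 - gamma i t) * (lambda i * mu 0 i) +
          (1 - gamma i t) * delta * eps i w) ^+ 2].
  by apply/seteqP; split => w /=; rewrite -residual2_gaussian ler_nM2l.
have sd : `|s| * delta ^+ 2 <= 1 / 4.
  rewrite ltr0_norm// /s opprK mulrAC ler_pdivrMr//; lra.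
apply: le_trans (gaussian_quadratic_tail neps _ _ ind _) _.
  by move=> i; exact: residual_weight_le.
rewrite -expected_residual_sumE lee_fin ler_expR.
have sB : s * BW t = - x by rewrite /s mulNr divfK// gt_eqF.
have h1 : s * (ER t - kappa) <= - (x / 2).
  have : s * (ER t - kappa) <= s * (BW t / 2) by rewrite ler_nM2l//; lra.
  have -> : s * (BW t / 2) = s * BW t / 2 by ring.
  rewrite sB; lra.
have h2 := residual_proxy_le tt.
have h3 : 4 * s ^+ 2 * (D%:R * delta ^+ 4 + delta ^+ 2 * BW t) <= x / 4.
  have e1 : s ^+ 2 * (D%:R * delta ^+ 4) <= 1 / 64.
    have : - s * (8 * Num.sqrt D%:R * delta ^+ 2) <= 1.
      rewrite /s opprK mulrAC ler_pdivrMr// mul1r; lra.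
    have p0 : 0 <= - s * (8 * Num.sqrt D%:R * delta ^+ 2).
      by rewrite mulr_ge0 ?oppr_ge0 ?(ltW sneg)// mulr_ge0 ?(ltW d20)// mulr_ge0.
    move=> p1; have := exprn_ile1 2 p0 p1.
    rewrite exprMn sqrrN (_ : (8 * Num.sqrt D%:R * delta ^+ 2) ^+ 2 =
      64 * (D%:R * delta ^+ 4)); last first.
      by rewrite -[X in _ = 64 * (X * _)](sqr_sqrtr (ler0n R D)); ring.
    lra.
  have e2 : s ^+ 2 * (delta ^+ 2 * BW t) <= x / 24.
    have -> : s ^+ 2 * (delta ^+ 2 * BW t) = s * BW t * (s * delta ^+ 2) by ring.
    have : - s * delta ^+ 2 <= 1 / 24.
      rewrite /s opprK mulrAC ler_pdivrMr//; lra.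
    rewrite sB; nra.
  lra.
have h4 : 4 * s ^+ 2 * (\sum_i (((1 - gamma i t) * delta) ^+ 4 +
          ((1 - gamma i t) * delta) ^+ 2 *
          ((1 - gamma i t) * (lambda i * mu 0 i)) ^+ 2)) <= x / 4.
  by apply: le_trans h3; rewrite ler_wpM2l// mulr_ge0// sqr_ge0.
lra.
Qed.

(** The numerator of the ratio in [oracle_factor], and the inverse of the Chernoff parameter for the
    upper tail. *)
Definition deviation_scale (B : R) :=
  (4 * Num.sqrt D%:R + 12) * delta ^+ 2 + Num.sqrt 32 * delta * B.

(** Chernoff at [s = 1 / G]: the gap [x G] contributes [- x]. Since
    [G^2 >= 16 (D delta^4 + delta^2 B^2)], the quadratic term is at most [1/4], and
    [1/4 - x <= - x / 4]. *)
Lemma residual_upper_tail (t x B : R) : 0 <= t -> 1 <= x -> 0 <= B ->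
  BW t <= B ^+ 2 -> ER t + x * deviation_scale B <= kappa ->
  (P [set w | (kappa <= residual2 gamma (Y w) t)%R] <=
   (expR (- (x / 4)))%:E)%E.
Proof.
move=> tt x1 B0 hB; set G := deviation_scale B => hk.
have d20 : 0 < delta ^+ 2 by rewrite exprn_gt0.
have q0 : 0 <= 4 * Num.sqrt D%:R * delta ^+ 2.
  by rewrite mulr_ge0 ?(ltW d20)// mulr_ge0.
have b0 : 0 <= Num.sqrt 32 * delta * B.
  by rewrite mulr_ge0// mulr_ge0// ltW.
have GE : G = 4 * Num.sqrt D%:R * delta ^+ 2 + 12 * delta ^+ 2 +
   Num.sqrt 32 * delta * B by rewrite /G /deviation_scale; ring.
have G0 : 0 < G by lra.
pose s := G^-1.
have s0 : 0 < s by rewrite invr_gt0.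
have sG : s * G = 1 by rewrite /s mulVf// gt_eqF.
have -> : [set w | (kappa <= residual2 gamma (Y w) t)%R] =
    [set w | s * kappa <= s * \sum_i ((1 - gamma i t) * (lambda i * mu 0 i) +
          (1 - gamma i t) * delta * eps i w) ^+ 2].
  by apply/seteqP; split => w /=; rewrite -residual2_gaussian ler_pM2l.
have sd : `|s| * delta ^+ 2 <= 1 / 4.
  by rewrite gtr0_norm// /s mulrC ler_pdivrMr//; lra.
clearbody s.
apply: le_trans (gaussian_quadratic_tail neps _ _ ind _) _.
  by move=> i; exact: residual_weight_le.
rewrite -expected_residual_sumE lee_fin ler_expR.
have h1 : s * ER t - s * kappa <= - x.
  have : s * (ER t + x * G) <= s * kappa by rewrite ler_pM2l.
  rewrite mulrDr mulrCA sG; lra.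
have h2 := residual_proxy_le tt.
have h3 : 4 * s ^+ 2 * (D%:R * delta ^+ 4 + delta ^+ 2 * B ^+ 2) <= 1 / 4.
  have e : 16 * (D%:R * delta ^+ 4 + delta ^+ 2 * B ^+ 2) <= G ^+ 2.
    have e1 : (4 * Num.sqrt D%:R * delta ^+ 2) ^+ 2 = 16 * (D%:R * delta ^+ 4).
      by rewrite -[X in _ = 16 * (X * _)](sqr_sqrtr (ler0n R D)); ring.
    have e2 : (Num.sqrt 32 * delta * B) ^+ 2 = 32 * (delta ^+ 2 * B ^+ 2).
      by rewrite -[X in _ = X * _](sqr_sqrtr (ler0n R 32)); ring.
    have e3 : 0 <= delta ^+ 2 * B ^+ 2 by rewrite mulr_ge0 ?sqr_ge0.
    rewrite GE; nra.
  have : s ^+ 2 * (16 * (D%:R * delta ^+ 4 + delta ^+ 2 * B ^+ 2)) <= 1.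
    by have := ler_wpM2l (sqr_ge0 s) e; rewrite -[leRHS]exprMn sG expr1n.
  lra.
have h4 : 4 * s ^+ 2 * (\sum_i (((1 - gamma i t) * delta) ^+ 4 +
          ((1 - gamma i t) * delta) ^+ 2 *
          ((1 - gamma i t) * (lambda i * mu 0 i)) ^+ 2)) <= 1 / 4.
  apply: le_trans h3; have s4 : 0 <= 4 * s ^+ 2 by rewrite mulr_ge0// sqr_ge0.
  apply: (ler_wpM2l s4); apply: (le_trans h2).
  by rewrite lerD2l ler_wpM2l// ltW.
lra.
Qed.

Lemma deviation_scale_gt0 B : 0 <= B -> 0 < deviation_scale B.
Proof.
move=> B0; apply: ltr_wpDr; first by rewrite mulr_ge0// mulr_ge0// ltW.
by rewrite mulr_gt0 ?exprn_gt0// ltr_wpDl// mulr_ge0.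
Qed.

(** Let [t'] be the time where the weak squared bias equals [b]. A larger bias at [tau] means
    [tau < t'], hence a residual at [t'] of at most [kappa], although its mean exceeds [kappa] by at
    least [b / 2]. *)
Lemma early_stopping_bias (x B b : R) : 1 <= x -> 0 <= B -> B ^+ 2 = BW tstar ->
  2 * (B ^+ 2 + x * deviation_scale B) <= b ->
  exists A, [/\ measurable A, (P A <= (expR (- (x / 4)))%:E)%E &
    forall w, ~ A w -> tau w <= tstar -> BW (tau w) <= b].
Proof.
move=> x1 B0 BE hb.
have x0 : 0 < x by lra.
have G0 := deviation_scale_gt0 B0.
have xG0 : 0 < x * deviation_scale B by rewrite mulr_gt0.
have Bb : BW tstar <= b by rewrite -BE; have := sqr_ge0 B; lra.
have tau0 w : 0 <= tau w := le_trans t00 (stopping_time_ge w).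
have [Bt0|Bt0] := leP (BW t0) b.
  exists set0; split => //; first by rewrite measure0 lee_fin expR_ge0.
  move=> w _ _; apply: le_trans Bt0; apply: filter_residual_le => //.
  exact: stopping_time_ge.
have [Bc Bd _] := residual_passage_hyps wl0.
have [|t' /andP[t0t' t't] Bt'] :=
    @first_passage_ivt R BW t0 Bc Bd t0 tstar b (lexx _) oracle_time_ge.
  by rewrite Bb ltW.
have tt : 0 <= t' := le_trans t00 t0t'.
have t0ts : t0 < tstar.
  rewrite lt_neqAle oracle_time_ge andbT; apply/eqP => e.
  by move: Bt0; rewrite e ltNge Bb.
exists [set w | residual2 gamma (Y w) t' <= kappa]; split.
- rewrite -[X in measurable X]setTI; apply: measurable_fun_le => //.
  exact: measurable_residual2.
- have d20 : 0 < delta ^+ 2 by rewrite exprn_gt0.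
  have B2 := sqr_ge0 B.
  have b1 : 0 <= Num.sqrt 32 * delta * B by rewrite mulr_ge0// mulr_ge0// ltW.
  have b2 : 0 <= Num.sqrt D%:R * delta ^+ 2 by rewrite mulr_ge0// ltW.
  have hx1 : 0 <= x * (Num.sqrt 32 * delta * B) by rewrite mulr_ge0// ltW.
  have hx2 : 0 <= x * (Num.sqrt D%:R * delta ^+ 2) by rewrite mulr_ge0// ltW.
  have hx3 : 0 <= x * delta ^+ 2 by rewrite mulr_ge0// ltW.
  move: hb; rewrite /deviation_scale => hb.
  apply: residual_lower_tail => //; rewrite ?Bt'; try lra.
  (* The noise part of the expected residual decreases in time. As [ER tstar = kappa], this gives
     [ER t' - kappa >= b - B^2 >= b / 2]. *)
  have ERd : ER t' - BW t' >= ER tstar - BW tstar.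
    rewrite /ER /BW /filter_residual -!sumrB; apply: ler_sum => i _.
    have e u : (1 - gamma i u) ^+ 2 * (wl i + delta ^+ 2) -
        (1 - gamma i u) ^+ 2 * wl i = (1 - gamma i u) ^+ 2 * delta ^+ 2 by ring.
    rewrite !e ler_wpM2r ?(ltW d20)//.
    have /andP[? ?] := spectral_filter_itv sf i tt.
    have /andP[? ?] := spectral_filter_itv sf i (le_trans tt t't).
    have [_ _ /(_ t' tstar tt t't) ? _ _] := sf i.
    by rewrite ler_pXn2r ?nnegrE//; lra.
  rewrite -(oracle_time_eq t0ts); lra.
- move=> w /negP; rewrite stopping_timeP// -ltNge => t'tau _.
  by rewrite -Bt'; apply: filter_residual_le => //; exact: ltW.
Qed.

Lemma weak_varianceE t : Vl t = delta ^+ 2 * filter_energy gamma (fun=> 1) t.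
Proof.
by congr (_ * _); apply: eq_bigr => i _; rewrite mulr1.
Qed.

Lemma weak_variance_le s t : 0 <= s -> s <= t -> Vl s <= Vl t.
Proof.
by move=> s0 st; rewrite !weak_varianceE ler_wpM2l ?sqr_ge0// filter_energy_le.
Qed.

Lemma weak_variance_ivt b c v : 0 <= b -> b <= c -> Vl b <= v <= Vl c ->
  exists2 t, b <= t <= c & Vl t = v.
Proof.
move=> b0 bc /andP[bv vc]; have [|||t] := @IVT R Vl b c v => //.
- have -> : Vl = (cst (delta ^+ 2) \* filter_energy gamma (fun=> 1)).
    by apply/funext => t; exact: weak_varianceE.
  move=> z; apply: cvgM; first exact: cvg_cst.
  apply: (continuous_subspaceW _ (filter_energy_continuous sf (w := fun=> 1))).
  move=> y /=; rewrite !in_itv/= andbT => /andP[by_ _]; exact: le_trans by_.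
- by rewrite ge_min bv le_max vc orbT.
- by rewrite in_itv/=; exists t.
Qed.

(** Let [t'] be the time where the weak variance equals [r^2 Vl tstar]. Stopping later means a
    residual above [kappa] at [t']. Yet the mean has dropped since [tstar] by at least the squared
    distance of the scaled filter vectors, which is at least [(r - 1)^2 Vl tstar] by the reverse
    triangle inequality. *)
Lemma late_stopping_variance (x B r : R) : 1 <= x -> 0 <= B ->
  B ^+ 2 = BW tstar -> 1 <= r ->
  x * deviation_scale B <= (r - 1) ^+ 2 * Vl tstar ->
  exists A, [/\ measurable A, (P A <= (expR (- (x / 4)))%:E)%E &
    forall w, ~ A w -> tstar <= tau w -> Vl (tau w) <= r ^+ 2 * Vl tstar].
Proof.
move=> x1 B0 BE r1 hr.
have ts0 : 0 <= tstar := le_trans t00 oracle_time_ge.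
have V0 t : 0 <= Vl t.
  by rewrite weak_varianceE mulr_ge0 ?sqr_ge0// filter_energy_ge0.
(* If the level is never exceeded after [tstar], the empty event suffices. *)
have [[s [ss hs]]|/forallNP nex] :=
    pselect (exists s, tstar <= s /\ r ^+ 2 * Vl tstar < Vl s); last first.
  exists set0; split => //; first by rewrite measure0 lee_fin expR_ge0.
  move=> w _ tw; rewrite leNgt; apply/negP => h; exact: (nex (tau w)).
have [|t' /andP[tst' t's] Vt'] :=
    @weak_variance_ivt tstar s (r ^+ 2 * Vl tstar) ts0 ss.
  by rewrite (ltW hs) andbT ler_peMl// exprn_ege1.
have tt : 0 <= t' := le_trans ts0 tst'.
exists [set w | kappa <= residual2 gamma (Y w) t']; split.
- rewrite -[X in measurable X]setTI; apply: measurable_fun_le => //.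
  exact: measurable_residual2.
- apply: (residual_upper_tail tt x1 B0).
    by rewrite BE; exact: filter_residual_le.
  apply: le_trans oracle_time_le; rewrite -lerBrDl.
  apply: (le_trans hr).
  (* [2 a b <= b^2 / r + r a^2] for the filter values a, b at [tstar], [t'] *)
  pose S t := \sum_(i < D) gamma i t ^+ 2.
  have SV t : Vl t = delta ^+ 2 * S t by [].
  have d20 : 0 < delta ^+ 2 by rewrite exprn_gt0.
  have r0 : 0 < r by lra.
  have St' : S t' = r ^+ 2 * S tstar.
    apply: (mulfI (lt0r_neq0 d20)).
    by rewrite -SV Vt' SV mulrCA.
  have cs : \sum_(i < D) gamma i tstar * gamma i t' <= r * S tstar.
    have : \sum_(i < D) 2 * (gamma i tstar * gamma i t') <=
        r^-1 * S t' + r * S tstar.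
      rewrite !mulr_sumr -big_split/=; apply: ler_sum => i _.
      rewrite -subr_ge0 (_ : _ - _ =
        r^-1 * (gamma i t' - r * gamma i tstar) ^+ 2).
        by rewrite mulr_ge0 ?sqr_ge0// invr_ge0 ltW.
      by field; exact: lt0r_neq0.
    rewrite -mulr_sumr St' (_ : r^-1 * (r ^+ 2 * S tstar) = r * S tstar).
      lra.
    by field; exact: lt0r_neq0.
  have e1 : (r - 1) ^+ 2 * S tstar <=
      \sum_(i < D) (gamma i t' - gamma i tstar) ^+ 2.
    have -> : \sum_(i < D) (gamma i t' - gamma i tstar) ^+ 2 =
        S t' + S tstar - 2 * \sum_(i < D) gamma i tstar * gamma i t'.
      rewrite mulr_sumr -big_split/= -sumrB; apply: eq_bigr => i _; ring.
    rewrite St'; lra.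
  apply: (@le_trans _ _ (\sum_(i < D) delta ^+ 2 *
      (gamma i t' - gamma i tstar) ^+ 2)).
    by rewrite SV mulrCA -mulr_sumr ler_wpM2l// ltW.
  rewrite /ER /filter_residual -sumrB; apply: ler_sum => i _.
  have /andP[? ?] := spectral_filter_itv sf i tt.
  have /andP[? ?] := spectral_filter_itv sf i ts0.
  have [_ _ /(_ tstar t' ts0 tst') ? _ _] := sf i.
  rewrite -mulrBl.
  (* With [a <= b <= 1], expanding [((1 - b) + (b - a))^2] leaves a nonnegative cross term. *)
  have e2 : (gamma i t' - gamma i tstar) ^+ 2 <=
      (1 - gamma i tstar) ^+ 2 - (1 - gamma i t') ^+ 2 by nra.
  apply: (@le_trans _ _ (delta ^+ 2 *
      ((1 - gamma i tstar) ^+ 2 - (1 - gamma i t') ^+ 2))).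
    by rewrite ler_wpM2l// ltW.
  rewrite mulrC ler_wpM2l ?lerDr//.
  by apply: le_trans e2; exact: sqr_ge0.
- move=> w /negP; rewrite -ltNge => Rk _.
  rewrite -Vt'; apply: weak_variance_le.
    exact: le_trans t00 (stopping_time_ge w).
  by rewrite -stopping_timeP ?(ltW Rk)// (le_trans oracle_time_ge).
Qed.

End Model.

(** The first passage results are applied to minus the energy. The level lies strictly between the
    energy 0 at time 0 and its limit [D], so it is attained, and the first time at which it is
    reached is the infimum of the equality set. *)
Lemma initial_timeP (R : realType) (D : nat) (gamma : 'I_D -> R -> R)
    (delta Ccirc : R) :
  (forall i, spectral_filter (gamma i)) -> 0 < delta -> 1 <= Ccirc ->
  Ccirc < Num.sqrt D%:R ->
  0 <= initial_time gamma delta Ccirc /\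
  weak_variance gamma delta (initial_time gamma delta Ccirc) =
    Ccirc * Num.sqrt D%:R * delta ^+ 2.
Proof.
move=> sf delta0 C1 CD; set v := Ccirc * Num.sqrt D%:R.
have d20 : delta ^+ 2 != 0 by rewrite lt0r_neq0// exprn_gt0.
have sD0 : 0 < Num.sqrt D%:R :> R by lra.
have v0 : 0 < v by rewrite mulr_gt0//; lra.
have vD : v < D%:R.
  by rewrite -[ltRHS](sqr_sqrtr (ler0n R D)) expr2 /v ltr_pM2r.
pose E := filter_energy gamma (fun=> 1); pose F t := - E t.
have Fc : {within `[0, +oo[, continuous F}.
  by move=> t; apply: cvgN; exact: filter_energy_continuous.
have Fd s t : 0 <= s -> s <= t -> F t <= F s.
  by move=> s0 st; rewrite lerN2; exact: filter_energy_le.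
have Fex : exists2 t, 0 <= t & F t <= - v.
  have [|t t0 vt] := @filter_energy_large _ _ _ sf (fun=> 1) 0 v.
    by rewrite sumr_const card_ord.
  by exists t; rewrite // lerN2.
pose tau := inf [set t | 0 <= t /\ F t <= - v].
have tau0 : 0 <= tau by exact: first_passage_ge.
have Etau : E tau = v.
  apply: oppr_inj; apply: (first_passage_eq Fc Fd Fex).
  rewrite lt_neqAle tau0 andbT; apply/eqP => e0.
  have := first_passage_le Fc Fd Fex; rewrite -e0 /F lerN2 => /(lt_le_trans v0).
  rewrite /E /filter_energy big1 ?ltxx// => i _.
  by have [_ _ _ -> _] := sf i; rewrite expr0n mul0r.
have VE t : weak_variance gamma delta t = delta ^+ 2 * E t.
  by congr (_ * _); apply: eq_bigr => i _; rewrite mulr1.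
have Vtau : weak_variance gamma delta tau = v * delta ^+ 2.
  by rewrite VE Etau mulrC.
suff -> : initial_time gamma delta Ccirc = tau by [].
apply/eqP; rewrite eq_le; apply/andP; split.
- by apply: ge_inf; [exists 0 => t []|split].
- apply: lb_le_inf; first by exists tau.
  move=> t [t0]; rewrite VE mulrC => /(mulIf d20) Et.
  by apply: ge_inf; [exists 0 => s []|split => //; rewrite /F Et].
Qed.

(** * The loss: bias, variance and transfer from weak to strong bias *)

Section Loss.
Context d (T : measurableType d) (R : realType) (P : probability T R).
Variables (D : nat) (delta : R) (lambda : 'I_D -> R) (mu : 'rV[R]_D).
Variables (gamma : 'I_D -> R -> R) (eps : 'I_D -> {RV P >-> R}).
Hypothesis neps : forall i, standard_normal (eps i).
Hypothesis sf : forall i, spectral_filter (gamma i).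
Hypothesis lambda0 : forall i, 0 < lambda i.

Let loss t w := enorm (estimator gamma lambda
  (observation lambda mu delta (fun i => eps i w)) t - mu) ^+ 2.
Let SB := filter_residual gamma (fun i => mu 0 i ^+ 2).

Lemma loss_gaussian t w : loss t w =
  \sum_i ((gamma i t - 1) * mu 0 i +
          gamma i t * delta * (lambda i)^-1 * eps i w) ^+ 2.
Proof.
rewrite /loss /enorm sqr_sqrtr; last by apply: sumr_ge0 => i _; exact: sqr_ge0.
by apply: eq_bigr => i _; rewrite !mxE; field; exact: lt0r_neq0.
Qed.

Lemma expectation_loss t :
  ('E_P[loss t] = (SB t + strong_variance gamma lambda delta t)%:E)%E.
Proof.
have -> : loss t = fun w => \sum_i ((gamma i t - 1) * mu 0 i +
    gamma i t * delta * (lambda i)^-1 * eps i w) ^+ 2.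
  by apply/funext => w; exact: loss_gaussian.
rewrite (expectation_gaussian_quadratic neps).
rewrite /SB /filter_residual /strong_variance mulr_sumr -big_split/=.
by congr EFin; apply: eq_bigr => i _; field; exact: lt0r_neq0.
Qed.

Lemma loss_le t w : loss t w <=
  2 * SB t + 2 * delta ^+ 2 *
    (\sum_i gamma i t ^+ 2 * (lambda i ^- 2 * eps i w ^+ 2)).
Proof.
rewrite loss_gaussian /SB /filter_residual !mulr_sumr -big_split/=.
apply: ler_sum => i _; rewrite -subr_ge0 (_ : _ - _ =
  ((gamma i t - 1) * mu 0 i - gamma i t * delta * (lambda i)^-1 * eps i w) ^+ 2).
  exact: sqr_ge0.
by field; exact: lt0r_neq0.
Qed.

(** The filters are continuous only on the half line, so the random time must be nonnegative for the
    composition to be measurable. *)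
Lemma measurable_loss (f : T -> R) : measurable_fun setT f ->
  (forall w, 0 <= f w) -> measurable_fun setT (fun w => loss (f w) w).
Proof.
move=> mf f0.
have mg i : measurable_fun setT (fun w => gamma i (f w)).
  have [_ gc _ _ _] := sf i.
  have mi : measurable_fun (`[0, +oo[%classic : set R) (gamma i).
    by apply: subspace_continuous_measurable_fun => //; exact: measurable_itv.
  apply: (measurable_comp _ _ mi mf); first exact: measurable_itv.
  by move=> _ [w _ <-]; rewrite /= in_itv/= andbT.
under eq_fun do rewrite loss_gaussian.
apply: measurable_sum => i; apply: measurable_funX; apply: measurable_funD.
- by apply: measurable_funM => //; exact: measurable_funB.
- apply: measurable_funM => //; apply: measurable_funM => //.
  exact: measurable_funM.
Qed.

(** Chebyshev's inequality with weights [mu_i^2], the antitone sequence [lambda_i^2] and the squared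
    ratio of (i): the strong bias grows backwards in time by at most the factor of the weak bias. *)
Lemma bias_ratio_le (t' t : R) :
  (forall i j : 'I_D, (i <= j)%N -> lambda j <= lambda i) ->
  0 <= t' -> t' <= t ->
  (forall i j : 'I_D, (i <= j)%N ->
     (ratio_infty (1 - gamma j t')%R (1 - gamma j t)%R <=
      ratio_infty (1 - gamma i t')%R (1 - gamma i t)%R)%E) ->
  SB t' * filter_residual gamma (fun i => lambda i ^+ 2 * mu 0 i ^+ 2) t <=
  filter_residual gamma (fun i => lambda i ^+ 2 * mu 0 i ^+ 2) t' * SB t.
Proof.
move=> ld t'0 t't hr; apply: chebyshev_sum_le.
- by move=> i; exact: sqr_ge0.
- move=> i j ij; rewrite ler_pXn2r ?nnegrE ?(ltW (lambda0 _))//; exact: ld.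
move=> i j ij; rewrite -!exprMn.
have g1 k s : 0 <= s -> 0 <= 1 - gamma k s.
  by move=> s0; have /andP[_ ?] := spectral_filter_itv sf k s0; rewrite subr_ge0.
have t0 := le_trans t'0 t't.
rewrite ler_pXn2r ?nnegrE ?mulr_ge0 ?g1//.
have := hr i j ij; rewrite /ratio_infty.
(* A vanishing denominator at [j] makes the ratio infinite there, and (i) then forces it to vanish
   at [i] too. *)
have [->|bj] := eqVneq (1 - gamma j t) 0.
  have [->|_] := eqVneq (1 - gamma i t) 0; first by rewrite !mulr0.
  by rewrite leye_eq.
have [->|bi] := eqVneq (1 - gamma i t) 0.
  by rewrite mulr0 mulr_ge0 ?g1.
rewrite lee_fin ler_pdivrMr; last by rewrite lt_neqAle eq_sym bj g1.
by rewrite mulrAC ler_pdivlMr// lt_neqAle eq_sym bi g1.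
Qed.

End Loss.

(** * Union bound and the oracle inequality *)

Lemma measure_finite_union_le d (T : measurableType d) (R : realType)
    (P : {measure set T -> \bar R}) (I : finType) (F : I -> set T) (e : I -> R) :
  (forall i, measurable (F i)) -> (forall i, (P (F i) <= (e i)%:E)%E) ->
  measurable (\big[setU/set0]_i F i) /\
  (P (\big[setU/set0]_i F i) <= (\sum_i e i)%:E)%E.
Proof.
move=> mF Fe; elim/big_rec2: _ => [|i y A _ [mA Ay]].
  by split => //; rewrite measure0.
split; first exact: measurableU.
rewrite EFinD; apply: (@le_trans _ _ (P (F i) + P A)%E).
  exact: measureU2.
exact: leeD.
Qed.

Theorem theorem2p8 (R : realType) (clambda : R) (hclambda : 0 < clambda) :
  exists c1 c2 : R, [/\ 0 < c1, 0 < c2 &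
  forall (D : nat) (delta : R) (lambda : 'I_D -> R) (mu : 'rV[R]_D)
    (gamma : 'I_D -> R -> R) (Ccirc kappa p CV : R)
    (d : measure_display) (T : measurableType d) (P : probability T R)
    (eps : 'I_D -> {RV P >-> R}),
  let Y := fun w : T => observation lambda mu delta (fun i => eps i w) in
  let t0 := initial_time gamma delta Ccirc in
  let tau := fun w : T => stopping_time gamma t0 kappa (Y w) in
  let tstar := oracle_time P gamma t0 kappa Y in
  let V := strong_variance gamma lambda delta in
  let Vl := weak_variance gamma delta in
  0 < delta ->
  (forall i, 0 < lambda i <= 1) ->
  (forall i j : 'I_D, (i <= j)%N -> lambda j <= lambda i) ->
  mutually_independent eps ->
  (forall i, standard_normal (eps i)) ->
  (forall i, spectral_filter (gamma i)) ->
  1 <= Ccirc -> Ccirc < Num.sqrt D%:R ->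
  0 < kappa ->
  1 <= p -> 1 <= CV ->
  (forall t t' : R, t0 <= t' -> t' <= t -> forall i j : 'I_D, (i <= j)%N ->
     (ratio_infty (1 - gamma j t')%R (1 - gamma j t)%R <=
      ratio_infty (1 - gamma i t')%R (1 - gamma i t)%R)%E) ->
  (forall i' i : 'I_D, (i' <= i)%N -> forall t : R, t0 <= t ->
     gamma i t <= gamma i' t) ->
  (forall t t' : R, t0 <= t' -> t' <= t ->
     V t <= CV * (Vl t / Vl t') `^ p * V t') ->
  (forall k : 'I_D,
     clambda ^+ 2 * lambda k ^- 2 <=
     (k.+1%:R)^-1 * \sum_(i < D | (i <= k)%N) lambda i ^- 2) ->
  forall x : R, 1 <= x ->
  ((1 - c1 * expR (- (c2 * x)))%:E <=
   P [set w | ((enorm (estimator gamma lambda (Y w) (tau w) - mu) ^+ 2)%:E <=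
      oracle_factor gamma lambda mu delta CV p t0 tstar x *
        'E_P[fun w' => (enorm (estimator gamma lambda (Y w') tstar - mu) ^+ 2)%R]
      + (2 * delta ^+ 2 * x * entry lambda (minn (Num.truncn x) D) ^- 2)%:E)%E])%E].
Proof.
pose c2 : R := Num.min (1 / 16) (clambda ^+ 2 / 32).
have c20 : 0 < c2 by rewrite lt_min !divr_gt0 ?exprn_gt0.
have c2a : c2 <= 1 / 16 by rewrite ge_min lexx.
have c2b : c2 <= clambda ^+ 2 / 32 by rewrite ge_min lexx orbT.
(* The 2 counts the early and late deviation events, and [c2^-1] bounds the geometric series over
   the noise events. *)
exists (2 + c2^-1), c2; split => //; first by rewrite addr_gt0// invr_gt0.
move=> D delta lambda mu gamma Ccirc kappa p CV d T P eps Y t0 tau tstar V Vl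
  delta0 lambda01 lambdad ind neps sf C1 CD kappa0 p1 CV1 hratio gammad hV hcl
  x x1.
have lambda0 i : 0 < lambda i by have /andP[] := lambda01 i.
have x0 : 0 < x by lra.
have D0 : (0 < D)%N.
  rewrite lt0n; apply/eqP => D0; move: CD; rewrite D0 sqrtr0; lra.
have [t00 Vt0] := initial_timeP sf delta0 C1 CD.
rewrite -/t0 in t00 Vt0.
have d20 : 0 < delta ^+ 2 by rewrite exprn_gt0.
have Vlt0 : 0 < Vl t0.
  by rewrite /Vl Vt0 !mulr_gt0 ?sqrtr_gt0 ?ltr0n//; lra.
have tst0 : t0 <= tstar by exact: oracle_time_ge.
have ts0 : 0 <= tstar := le_trans t00 tst0.
have Vlmono s t : 0 <= s -> s <= t -> Vl s <= Vl t by exact: weak_variance_le.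
have Vlts : 0 < Vl tstar by apply: lt_le_trans Vlt0 _; exact: Vlmono.
pose SB := filter_residual gamma (fun i => mu 0 i ^+ 2).
pose BW := filter_residual gamma (fun i => lambda i ^+ 2 * mu 0 i ^+ 2).
have mu0 i : 0 <= mu 0 i ^+ 2 by exact: sqr_ge0.
have SB0 t : 0 <= SB t by exact: filter_residual_ge0.
have Vmono s t : 0 <= s -> s <= t -> V s <= V t.
  move=> s0 st; rewrite /V /strong_variance ler_wpM2l ?sqr_ge0//.
  by apply: filter_energy_le => // i; rewrite invr_ge0 sqr_ge0.
have VlV t : Vl t <= V t.
  rewrite /Vl /V /weak_variance /strong_variance ler_wpM2l ?sqr_ge0//.
  apply: ler_sum => i _; rewrite ler_peMr ?sqr_ge0// invf_ge1 ?exprn_gt0//.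
  by have /andP[? ?] := lambda01 i; rewrite exprn_ile1// ltW.
have Vts : 0 < V tstar := lt_le_trans Vlts (VlV _).
have tau0 w : t0 <= tau w by exact: stopping_time_ge.
have tau00 w : 0 <= tau w := le_trans t00 (tau0 w).
have mtau : measurable_fun setT tau by exact: measurable_stopping_time.
have mloss := measurable_loss delta mu eps sf lambda0 mtau tau00.
rewrite (expectation_loss delta mu gamma neps lambda0 tstar) -/(SB _) -/(V _).
set y := 2 * delta ^+ 2 * x * _.
set B := weak_bias gamma lambda mu tstar.
have B0 : 0 <= B by exact: sqrtr_ge0.
have BE : B ^+ 2 = BW tstar by exact: weak_bias_sqr.
rewrite /oracle_factor -/B -/(Vl tstar) -/(Vl t0).
(* For a vanishing denominator the factor is infinite. The oracle risk is positive because the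
   variance is, so the product is infinite, not the default 0, and the event is everything. *)
set den := (t0 < tstar)%R%:R * _ + _; have [_|denN0] := eqVneq den 0.
  rewrite gt0_mulye ?lte_fin ?ltr_wpDl// addye//.
  rewrite (_ : [set w | _] = setT); last first.
    by apply/seteqP; split => w //= _; rewrite leey.
  rewrite probability_setT lee_fin gerBl mulr_ge0 ?expR_ge0// addr_ge0//.
  by rewrite invr_ge0 ltW.
set G := _ + Num.sqrt 32 * delta * B.
have GE : G = deviation_scale D delta B by [].
have G0 : 0 < G by rewrite GE; exact: deviation_scale_gt0.
have denV : den <= Vl tstar.
  rewrite /den; case: (ltgtP t0 tstar) => [lt|gt|eq].
  - by rewrite mul1r mul0r addr0 ge_min lexx.
  - by move: tst0; rewrite leNgt gt.
  - by rewrite mul0r mul1r add0r -eq.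
have denB : t0 < tstar -> den <= B ^+ 2.
  move=> lt; rewrite /den lt gt_eqF// mul1r mul0r addr0.
  by rewrite ge_min lexx orbT.
have den0 : 0 < den.
  rewrite lt_neqAle eq_sym denN0/=; apply: addr_ge0; apply: mulr_ge0 => //.
    by rewrite le_min (ltW Vlts) sqr_ge0.
  exact: ltW.
(* The factor is [4 CV r^(2p)], and [(r - 1)^2 z >= x G] for every [z >= den]: this is what both
   deviation lemmas ask, with [z] the squared weak bias or the weak variance at [tstar]. *)
set r := 1 + Num.sqrt _.
have q0 : 0 <= G / den * x by rewrite mulr_ge0 ?divr_ge0 ?ltW.
have r1 : 1 <= r by rewrite lerDl.
have rE : (r - 1) ^+ 2 = G / den * x by rewrite /r addrAC subrr add0r sqr_sqrtr.
have qle z : den <= z -> x * G <= (r - 1) ^+ 2 * z.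
  move=> dz; apply: (@le_trans _ _ ((r - 1) ^+ 2 * den)).
    by rewrite rE mulrAC divfK// mulrC.
  by rewrite ler_wpM2l ?sqr_ge0.
pose rp := r `^ (2 * p).
have rpE : (r ^+ 2) `^ p = rp.
  by rewrite -powR_mulrn ?(le_trans ler01)// -powRrM.
have r2rp : r ^+ 2 <= rp.
  rewrite -rpE -[leLHS]powRr1 ?sqr_ge0//.
  by apply: ler_powR => //; exact: exprn_ege1.
have r21 : 1 <= r ^+ 2 by exact: exprn_ege1.
have [A1 [mA1 PA1 hA1]] : exists A1, [/\ measurable A1,
    (P A1 <= (expR (- (x / 4)))%:E)%E &
    forall w, ~ A1 w -> tau w <= tstar -> SB (tau w) <= 2 * r ^+ 2 * SB tstar].
  (* If [tstar = t0], then [tau <= tstar] forces equality and no exceptional event is needed. *)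
  have [tlt|tge] := ltP t0 tstar; last first.
    exists set0; split => //; first by rewrite measure0 lee_fin expR_ge0.
    move=> w _ tw; have -> : tau w = tstar.
      by apply/eqP; rewrite eq_le tw (le_trans tge).
    by rewrite ler_peMl//; lra.
  have [|A1 [mA1 PA1 hA1]] := early_stopping_bias delta0 ind neps sf kappa0 t00
      (b := 2 * r ^+ 2 * B ^+ 2) x1 B0 BE.
    (* Since [r >= 1] gives [1 + (r - 1)^2 <= r^2], the level [2 r^2 B^2] is admissible. *)
    have := qle _ (denB tlt); have := sqr_ge0 B; rewrite -GE; nra.
  exists A1; split => // w nA tw; have := hA1 w nA tw => hb.
  have Bp : 0 < B ^+ 2 := lt_le_trans den0 (denB tlt).
  have := bias_ratio_le mu sf lambda0 lambdad (tau00 w) tw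
    (hratio tstar (tau w) (tau0 w) tw).
  rewrite -/(SB (tau w)) -/(SB tstar) -/(BW tstar) -BE => h.
  rewrite -(ler_pM2r Bp); apply: (le_trans h).
  by rewrite mulrAC; apply: ler_wpM2r.
have [A2 [mA2 PA2 hA2]] := late_stopping_variance delta0 ind neps sf kappa0 t00
  x1 B0 BE r1 (qle _ denV).
pose yk := x * entry lambda (minn (Num.truncn x) D) ^- 2.
pose F k := noise_event eps lambda k yk.
have [mF PF] := measure_finite_union_le (P := P) (F := F)
  (e := fun k : 'I_D => expR (- (c2 * x)) * expR (- (c2 * k.+1%:R)))
  (fun k => measurable_noise_event _ _ _ _)
  (fun k => noise_event_uniform_le ind neps lambda0 lambdad hclambda c20 c2a c2b
    x1 (hcl k)).
set FU := \big[setU/set0]_i F i in mF PF.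
have good w : ~ (A1 `|` A2 `|` FU) w ->
    enorm (estimator gamma lambda (Y w) (tau w) - mu) ^+ 2 <=
    4 * CV * rp * (SB tstar + V tstar) + y.
  move=> /not_orP[/not_orP[nA1 nA2] nF].
  have nFk k : ~ F k w.
    by move=> Fk; apply: nF; rewrite /FU (bigD1 k)//=; left.
  have g1 i : 0 <= gamma i (tau w) <= 1 by exact: spectral_filter_itv.
  have gd (i j : 'I_D) : (i <= j)%N -> gamma j (tau w) <= gamma i (tau w).
    by move=> ij; exact: gammad.
  have hN := weighted_noise_le (ltW x0) gd g1 nFk.
  have hL : enorm (estimator gamma lambda (Y w) (tau w) - mu) ^+ 2 <=
      2 * SB (tau w) + 4 * V (tau w) + y.
    apply: (le_trans (loss_le _ _ _ _ _ _ _)) => //.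
    rewrite -addrA lerD2l.
    have -> : 4 * V (tau w) + y = 2 * delta ^+ 2 *
        (2 * (\sum_i gamma i (tau w) ^+ 2 * lambda i ^- 2) + yk).
      by rewrite /V /strong_variance /y /yk; ring.
    by rewrite ler_wpM2l// mulr_ge0// ltW.
  apply: (le_trans hL); rewrite lerD2r.
  have CVrp : rp <= CV * rp.
    by rewrite ler_peMl// (le_trans _ r2rp)// (le_trans ler01).
  (* Monotonicity handles one term in each case: the variance when stopping early, the bias when
     stopping late. The other term costs [2 r^2] or, by (iii), [CV r^(2p)]; with the coefficients 2
     and 4 from the loss this explains the 4 in the factor. *)
  have [tw|/ltW tw] := leP (tau w) tstar.
  - have h1 := hA1 w nA1 tw; have h2 := Vmono _ _ (tau00 w) tw.
    have h3 : r ^+ 2 * SB tstar <= CV * rp * SB tstar.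
      by rewrite ler_wpM2r// (le_trans r2rp).
    have h4 : V tstar <= CV * rp * V tstar.
      by rewrite ler_peMl ?(ltW Vts)// (le_trans r21)// (le_trans r2rp).
    lra.
  - have h1 : SB (tau w) <= SB tstar by exact: filter_residual_le.
    have h2 : V (tau w) <= CV * rp * V tstar.
      apply: (le_trans (hV _ _ tst0 tw)); rewrite ler_wpM2r ?(ltW Vts)//.
      rewrite ler_wpM2l ?(le_trans ler01)// -rpE.
      have Vq0 : 0 <= Vl (tau w) / Vl tstar.
        apply: divr_ge0; last exact: ltW.
        by apply: (le_trans (ltW Vlts)); exact: Vlmono.
      apply: ge0_ler_powR; rewrite ?nnegrE ?sqr_ge0 ?Vq0//.
        exact: le_trans p1.
      by rewrite ler_pdivrMr//; exact: hA2.
    have h3 : SB tstar <= CV * rp * SB tstar.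
      by rewrite ler_peMl// (le_trans r21)// (le_trans r2rp).
    have := SB0 tstar; lra.
rewrite -EFinM -EFinD.
set C := _ + y; have CE : C = 4 * CV * rp * (SB tstar + V tstar) + y by [].
rewrite -CE in good.
pose Bad := A1 `|` A2 `|` FU.
have mBad : measurable Bad by apply: measurableU => //; exact: measurableU.
apply: (@le_trans _ _ (P (~` Bad))); last first.
  apply: le_measure; rewrite ?inE; [exact: measurableC| |].
  - under eq_set do rewrite lee_fin.
    by rewrite -[X in measurable X]setTI; apply: measurable_fun_le.
  - by move=> w nB /=; rewrite lee_fin good.
rewrite probability_setC// EFinB leeB//.
have e4 : expR (- (x / 4)) <= expR (- (c2 * x)) by rewrite ler_expR; nra.
have PF' : (P FU <= (c2^-1 * expR (- (c2 * x)))%:E)%E.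
  apply: (le_trans PF); rewrite lee_fin -mulr_sumr mulrC ler_wpM2r ?expR_ge0//.
  exact: sum_expR_geometric_le.
have mA12 : measurable (A1 `|` A2) by exact: measurableU.
have PA12 : (P (A1 `|` A2) <= P A1 + P A2)%E by exact: measureU2.
have PBad : (P Bad <= P (A1 `|` A2) + P FU)%E by exact: measureU2.
apply: (le_trans PBad); rewrite mulrDl EFinD; apply: leeD => //.
apply: (le_trans PA12).
rewrite (_ : 2 * _ = expR (- (c2 * x)) + expR (- (c2 * x))); last by ring.
by rewrite EFinD; apply: leeD;
  [apply: (le_trans PA1)|apply: (le_trans PA2)]; rewrite lee_fin.
Qed.
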